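(* Let $f\in L^2(\mathbb T)$ with Fourier series $f\sim\sum_{j\in\mathbb Z}a_je_j$, $a_0=0$, and assume that for some real $M>1$ $$L=\sum_{v=0}^\infty M^{v}\Big(\sup_{M^v\le |j|<M^{v+1}}|a_j|^2\Big)<\infty .$$ Let $\mathcal N=\{n_k,k\ge1\}$ be an increasing sequence of positive integers. For $t>0$ and any sequence $\mathbf c=\{c_k,k\ge 0\}$ of reals put $S_t(\mathbf c)=\sum_{k\in\mathcal N,\,k\le t}c_kf_k$. (a) Assume that for any $\mu>1$, $\sup_{j\ge0}\vartheta_{\mathcal N\cap[\mu^j,\mu^{j+1}[}<\infty$. Then (for any $\mu>1$) there exists a constant $C$ such that for any $\mathbf c\in\ell_2$, $$\Big(\sum_{j\ge0}\big\|S_{\mu^{j+1}}(\mathbf c)-S_{\mu^j}(\mathbf c)\big\|_2^2\Big)^{1/2}\le C\|\mathbf c\|_2 .$$ (b) Assume that for any $\mu>1$, $\vartheta_{\mathcal N\cap[\mu^j,\mu^{j+1}[}=o(1)$ as $j\to\infty$. If the coefficient sequences $\mathbf a=\{a_j\}$ and $\mathbf c\in\ell_2$ each have constant sign, then (for any $\mu>1$, with a constant $C$ not depending on $\mathbf c$) $$\|\mathbf c\|_2\le\Big(\sum_{j\ge0}\big\|S_{\mu^{j+1}}(\mathbf c)-S_{\mu^j}(\mathbf c)\big\|_2^2\Big)^{1/2}\le C\|\mathbf c\|_2 .$$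
   Context: $\mathbb T=\mathbb R/\mathbb Z$, $e_n(x)=\exp(2i\pi nx)$ for $n\in\mathbb Z$, $f_k(x)=f(kx)$, and $\|\cdot\|_2$ denotes the norm of $L^2(\mathbb T)$ (for functions) or of $\ell_2$ (for sequences). For a set $K$ of positive integers and $k\in K$, $\vartheta_K(k)=\sum_{\ell\in K,\ \ell\ne k}\frac{(\ell,k)}{\ell\vee k}$, where $(\ell,k)$ is the greatest common divisor and $\ell\vee k=\max(\ell,k)$; $\vartheta_K=\sup_{k\in K}\vartheta_K(k)$, with $\vartheta_\emptyset=0$. A real sequence has constant sign if all its terms are $\ge0$ or all its terms are $\le0$.
   Formalization: In (b) the left-hand inequality, false as printed (e.g. f = 0), is replaced by ‖f‖₂ times the ℓ₂ norm of c restricted to indices k in 𝒩 with k > 1, bounded by the square function; everything else is as stated. *)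

(* Defs.v *)
From HB Require Import structures.
From mathcomp Require Import all_boot all_order all_algebra.
From mathcomp Require Import complex.
From mathcomp Require Import all_classical all_reals all_analysis.

Set Implicit Arguments.
Unset Strict Implicit.
Unset Printing Implicit Defensive.

Import Order.TTheory GRing.Theory Num.Theory.
Import numFieldNormedType.Exports.

Local Open Scope classical_set_scope.
Local Open Scope complex_scope.
Local Open Scope ring_scope.

Section Circle.
Context {R : realType}.

(* Functions on T = R/Z are represented by 1-periodic functions on the line,
   and the normalized Haar measure of T by Lebesgue measure on [0, 1]. *)
Definition circle_measure : {measure set (measurableTypeR R) -> \bar R} :=
  mrestr (@lebesgue_measure R) (measurable_itv `[0, 1]).

Definition cmodulus (z : R[i]) : R := ComplexField.Normc.normc z.

Definition L2norm (f : R -> R[i]) : \bar R :=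
  ('N[circle_measure]_(2%:E)[EFin \o (cmodulus \o f)])%E.

Definition L2circle (f : R -> R[i]) : Prop :=
  [/\ periodic f 1,
      measurable_fun [set: R] (fun x => complex.Re (f x)),
      measurable_fun [set: R] (fun x => complex.Im (f x))
    & (L2norm f < +oo)%E].

Definition character (n : int) (x : R) : R[i] :=
  cos (2 * pi * n%:~R * x) +i* sin (2 * pi * n%:~R * x).

Definition Cintegral (g : R -> R[i]) : R[i] :=
  Rintegral circle_measure setT (fun x => complex.Re (g x)) +i*
  Rintegral circle_measure setT (fun x => complex.Im (g x)).

Definition fourier_coef (f : R -> R[i]) (j : int) : R[i] :=
  Cintegral (fun x => f x * character (- j) x).

Definition fourier_series (f : R -> R[i]) (a : int -> R[i]) : Prop :=
  forall j, a j = fourier_coef f j.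

Definition dilate (f : R -> R[i]) (k : nat) : R -> R[i] :=
  fun x => f (k%:R * x).

(* 0 is adjoined to the set because a window M^v <= |j| < M^(v+1) may contain
   no integer, and [ereal_sup set0] is -oo rather than 0. *)
Definition window_sup (a : int -> R[i]) (M : R) (v : nat) : \bar R :=
  ereal_sup (0%E |` [set (cmodulus (a j) ^+ 2)%:E |
    j in [set j : int | M ^+ v <= `|j|%:~R < M ^+ v.+1]]).

Definition window_series (a : int -> R[i]) (M : R) : \bar R :=
  (\sum_(0 <= v <oo) ((M ^+ v)%:E * window_sup a M v))%E.

Definition ell2norm (c : nat -> R) : \bar R :=
  ('N[counting]_(2%:E)[EFin \o c])%E.

Definition ell2 (c : nat -> R) : Prop := (ell2norm c < +oo)%E.

Definition vartheta_at (K : set nat) (k : nat) : \bar R :=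
  (\esum_(l in K `\ k) ((gcdn l k)%:R / (maxn l k)%:R)%:E)%E.

(* The terms are nonnegative, so adjoining 0 only serves to give the empty set
   the value 0. *)
Definition vartheta (K : set nat) : \bar R :=
  ereal_sup (0%E |` [set vartheta_at K k | k in K]).

Definition block (N : set nat) (mu : R) (j : nat) : set nat :=
  N `&` [set k : nat | mu ^+ j <= k%:R < mu ^+ j.+1].

Definition dilated_sum (f : R -> R[i]) (N : set nat) (c : nat -> R) (t : R) :
    R -> R[i] :=
  fun x => \sum_(k \in N `&` [set k : nat | k%:R <= t])
    (c k)%:C * dilate f k x.

Definition increment (f : R -> R[i]) (N : set nat) (c : nat -> R) (mu : R)
    (j : nat) : R -> R[i] :=
  fun x => dilated_sum f N c (mu ^+ j.+1) x - dilated_sum f N c (mu ^+ j) x.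

Definition square_function (f : R -> R[i]) (N : set nat) (c : nat -> R)
    (mu : R) : \bar R :=
  ((\sum_(0 <= j <oo) L2norm (increment f N c mu j) ^+ 2) `^ 2^-1)%E.

End Circle.

(* The increments S_{mu^(j+1)} - S_{mu^j}, j >= 0, involve exactly the indices
   k in N with k > mu^0 = 1: the coefficients c_k with k outside N never occur,
   and c_1 cancels out of every increment. *)
Definition active (N : set nat) : set nat := N `&` [set k | (1 < k)%N].

(* For K = R[i] the order is that of a numDomainType, so each alternative also
   says that all the terms are real. *)
Definition constant_sign (I : Type) (K : numDomainType) (u : I -> K) : Prop :=
  (forall i, 0 <= u i) \/ (forall i, u i <= 0).

Definition index_set (n : nat -> nat) : set nat := n @` [set k | (1 <= k)%N].

(* Main.v *)
Require Import Defs.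
From HB Require Import structures.
From mathcomp Require Import all_boot all_order all_algebra.
From mathcomp Require Import complex.
From mathcomp Require Import all_classical all_reals all_analysis.
From mathcomp Require Import measurable_realfun.
From mathcomp Require finmap.
From mathcomp Require Import ring lra.

(** The theorem is a Schur test for the Gram matrix of the dilates [f_k].

Since [f_k] has the Fourier series [sum_j a_j e_(jk)], the inner product of
[f_k] and [f_l] is the sum of [a_j] times the conjugate of [a_i] over the
solutions of [jk = il].  With [d = gcd(k,l)] these are the pairs
[j = (l/d)h], [i = (k/d)h], so the inner product is at most the half sum of the
energies [sum |a_j|^2] over the multiples of [l/d] and of [k/d] ([gram_le]).
There are at most [2 M^(v+1) / q] multiples of [q] in the annulus
[M^v <= |j| < M^(v+1)], hence the energy of the multiples of [q] is at most
[2ML/q] ([multiple_energy_le]); for [k] and [l] of comparable size this gives a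
Gram entry of size [O(gcd(k,l) / max(k,l))] ([gram_le_gcd]).  The row sums over
a block are then [O(1 + vartheta)], and [2|c_k c_l| <= c_k^2 + c_l^2] bounds the
quadratic form ([quadratic_form_le]).  When the signs are constant all terms of
the quadratic form are nonnegative and its diagonal alone gives the lower bound
([sqnorm_combination_ge]).

The computation of the quadratic form is carried out for the partial sums of
the Fourier series, where it is finite algebra with orthonormal characters
([sqnorm_fourier_combination]), and is then transferred to [f]: the partial sums
converge to [f] in mean ([cvg_fourier_partial]), and dilations preserve the
norm of a periodic function ([sqnorm_dilate]).  Mean convergence follows from
the best approximation property ([fourier_partial_best]) and from the density of
trigonometric polynomials ([trig_dense_inL2]).  For the density, if [p] is a
trigonometric polynomial with values in [[0,1]] then [(1 - p^m)^(K^m)] tends to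
the indicator of [Kp < 1] ([power_threshold]); for a suitable cosine [p] this is
the indicator of an arc, and the Dynkin lemma and dominated convergence lead
from arcs to measurable sets, simple functions and all of [L^2].

The increments run over the intervals [mu^j < k <= mu^(j+1)], whereas the blocks
are the intervals [mu^j <= k < mu^(j+1)]: the possible index [k = mu^(j+1)] is
split off, at the price of a factor 2 ([sqnorm_increment_le]).  Summing over [j]
then only uses that the intervals are disjoint ([sum_incr_range]). *)

Set Implicit Arguments.
Unset Strict Implicit.
Unset Printing Implicit Defensive.

Import Order.TTheory GRing.Theory Num.Theory.
Import numFieldNormedType.Exports.

Local Open Scope classical_set_scope.
Local Open Scope ring_scope.

(** * The square-integrable functions on the circle *)

Section Dot.
Context {R : realType}.
Implicit Types z w : R[i].

(** The inner product of the real plane [R[i]], which is the real part of [z] times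
the conjugate of [w].  A real inner product is enough: the coefficients [c_k] are
real, and a complex Fourier coefficient is recovered from its inner products
with [1] and [i]. *)
Definition dot z w : R :=
  complex.Re z * complex.Re w + complex.Im z * complex.Im w.

Lemma dotC z w : dot z w = dot w z.
Proof. by rewrite /dot mulrC [X in _ + X]mulrC. Qed.

Lemma dotDl z1 z2 w : dot (z1 + z2) w = dot z1 w + dot z2 w.
Proof. by case: z1 => ? ?; case: z2 => ? ?; rewrite /dot /=; ring. Qed.

Lemma dotZl (r : R) z w : dot (r%:C%C * z) w = r * dot z w.
Proof. by case: z => ? ?; rewrite /dot /=; ring. Qed.

Lemma dot0l w : dot 0 w = 0.
Proof. by rewrite /dot /= !mul0r addr0. Qed.

Lemma dot_ge0 z : 0 <= dot z z.
Proof. by rewrite /dot -!expr2 addr_ge0 ?sqr_ge0. Qed.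

Lemma dotM z w : dot (z * w) (z * w) = dot z z * dot w w.
Proof. by case: z => ? ?; case: w => ? ?; rewrite /dot /=; ring. Qed.

Lemma dot_le z w : `|dot z w| <= (dot z z + dot w w) / 2.
Proof.
case: z => a b; case: w => c d; rewrite /dot /=.
have h1 := sqr_ge0 (a - c); have h2 := sqr_ge0 (b - d).
have h3 := sqr_ge0 (a + c); have h4 := sqr_ge0 (b + d).
rewrite ler_norml; apply/andP; split; nra.
Qed.

Lemma cmodulus2 z : cmodulus z ^+ 2 = dot z z.
Proof.
by case: z => a b; rewrite /cmodulus /dot /= sqr_sqrtr ?addr_ge0 ?sqr_ge0//
  !expr2.
Qed.

Lemma cmodulus_ge0 z : 0 <= cmodulus z.
Proof. by case: z => a b; exact: sqrtr_ge0. Qed.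

End Dot.

Section L2.
Context {R : realType}.
Implicit Types F G H : R -> R[i].
Local Notation mu := (@circle_measure R).

Lemma circle_measureT : mu setT = 1%E.
Proof.
by rewrite /circle_measure /= /mrestr setTI lebesgue_measure_itv/= lte_fin
  ltr01 oppr0 adde0.
Qed.

Definition cmeasurable F :=
  measurable_fun setT (fun x : R => complex.Re (F x)) /\
  measurable_fun setT (fun x : R => complex.Im (F x)).

Definition inL2 F := cmeasurable F /\
  mu.-integrable setT (fun x => (dot (F x) (F x))%:E).

(** The real part of the Hermitian inner product of [L^2]. *)
Definition ip F G : R := Rintegral mu setT (fun x => dot (F x) (G x)).

Lemma cmeasurable_dot F G : cmeasurable F -> cmeasurable G ->
  measurable_fun setT (fun x => dot (F x) (G x)).
Proof.
by move=> [? ?] [? ?]; apply: measurable_funD; apply: measurable_funM.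
Qed.

Lemma cmeasurableD F G : cmeasurable F -> cmeasurable G ->
  cmeasurable (fun x => F x + G x).
Proof.
move=> [? ?] [? ?]; split.
  rewrite (_ : (fun x => _) = (fun x => complex.Re (F x) + complex.Re (G x))).
    exact: measurable_funD.
  by apply/funext => x; case: (F x) => ? ?; case: (G x) => ? ?.
rewrite (_ : (fun x => _) = (fun x => complex.Im (F x) + complex.Im (G x))).
  exact: measurable_funD.
by apply/funext => x; case: (F x) => ? ?; case: (G x) => ? ?.
Qed.

Lemma cmeasurableM F G : cmeasurable F -> cmeasurable G ->
  cmeasurable (fun x => F x * G x).
Proof.
move=> [? ?] [? ?]; split.
  rewrite (_ : (fun x => _) = (fun x => complex.Re (F x) * complex.Re (G x)
     - complex.Im (F x) * complex.Im (G x))).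
    by apply: measurable_funB; apply: measurable_funM.
  by apply/funext => x; case: (F x) => ? ?; case: (G x) => ? ?.
rewrite (_ : (fun x => _) = (fun x => complex.Re (F x) * complex.Im (G x)
     + complex.Im (F x) * complex.Re (G x))).
  by apply: measurable_funD; apply: measurable_funM.
by apply/funext => x; case: (F x) => ? ?; case: (G x) => ? ?.
Qed.

Lemma cmeasurable_cst z : cmeasurable (fun=> z).
Proof. by split; exact: measurable_cst. Qed.

Lemma inL2_dot F G : inL2 F -> inL2 G ->
  mu.-integrable setT (fun x => (dot (F x) (G x))%:E).
Proof.
move=> [mF iF] [mG iG].
apply: (@le_integrable _ _ _ mu _ measurableT _
  (fun x => ((dot (F x) (F x))%:E + (dot (G x) (G x))%:E)%E)).
- by apply/measurable_EFinP; exact: cmeasurable_dot.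
- move=> x _ /=; rewrite lee_fin [leRHS]ger0_norm; last by apply: addr_ge0;
    exact: dot_ge0.
  apply: (le_trans (dot_le _ _)).
  have := dot_ge0 (F x); have := dot_ge0 (G x); lra.
- exact: (integrableD measurableT iF iG).
Qed.

Lemma inL2D F G : inL2 F -> inL2 G -> inL2 (fun x => F x + G x).
Proof.
move=> F2 G2; split; first by apply: cmeasurableD; [case: F2|case: G2].
rewrite (_ : (fun x => _) =
  (fun x => (dot (F x) (F x))%:E + (dot (F x) (G x))%:E
   + ((dot (F x) (G x))%:E + (dot (G x) (G x))%:E))%E).
  apply: integrableD => //; apply: integrableD => //; exact: inL2_dot.
apply/funext => x; rewrite -!EFinD; congr EFin.
by rewrite dotDl ![dot _ (_ + _)]dotC !dotDl [dot (G x) (F x)]dotC.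
Qed.

Lemma inL2Z z F : inL2 F -> inL2 (fun x => z * F x).
Proof.
move=> [mF iF]; split; first by apply: cmeasurableM => //;
  exact: cmeasurable_cst.
rewrite (_ : (fun x => _) = (fun x => (dot z z)%:E * (dot (F x) (F x))%:E)%E).
  exact: integrableZl.
by apply/funext => x; rewrite dotM.
Qed.

Lemma inL2N F : inL2 F -> inL2 (fun x => - F x).
Proof.
by move=> /(inL2Z (-1)); under [X in inL2 X]eq_fun do rewrite mulN1r.
Qed.

Lemma inL2B F G : inL2 F -> inL2 G -> inL2 (fun x => F x - G x).
Proof. by move=> F2 G2; apply: inL2D => //; exact: inL2N. Qed.

Lemma inL2_0 : inL2 (fun=> 0).
Proof.
split; first exact: cmeasurable_cst.
by under eq_fun do rewrite dot0l; exact: integrable0.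
Qed.

Lemma inL2_sum I (s : seq I) (P : pred I) (F : I -> R -> R[i]) :
  (forall i, inL2 (F i)) -> inL2 (fun x => \sum_(i <- s | P i) F i x).
Proof.
move=> F2; elim: s => [|i s ih]; first by under eq_fun do rewrite big_nil;
  exact: inL2_0.
rewrite (_ : (fun x => _) =
  if P i then fun x => F i x + \sum_(i <- s | P i) F i x
  else fun x => \sum_(i <- s | P i) F i x); first by case: ifP => // _;
    exact: inL2D.
by apply/funext => x; rewrite big_cons; case: ifP.
Qed.

Lemma inL2_bounded F (C : R) : cmeasurable F ->
  (forall x, dot (F x) (F x) <= C) -> inL2 F.
Proof.
move=> mF FC; split => //.
apply: (@le_integrable _ _ _ mu _ measurableT _ (cst C%:E)).
- by apply/measurable_EFinP; exact: cmeasurable_dot.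
- by move=> x _ /=; rewrite lee_fin ger0_norm ?dot_ge0// (le_trans (FC x))//
    ler_norm.
- apply/integrableP; split; first exact: measurable_cst.
  under eq_integral do rewrite /=.
  by rewrite integral_cst// circle_measureT mule1 ltry.
Qed.

Lemma ipC F G : ip F G = ip G F.
Proof. by apply: eq_Rintegral => x _; rewrite dotC. Qed.

Lemma ipDl F G H : inL2 F -> inL2 G -> inL2 H ->
  ip (fun x => F x + G x) H = ip F H + ip G H.
Proof.
move=> F2 G2 H2; rewrite /ip -RintegralD//; try exact: inL2_dot.
by apply: eq_Rintegral => x _; rewrite dotDl.
Qed.

Lemma ipZl (r : R) F G : inL2 F -> inL2 G ->
  ip (fun x => r%:C%C * F x) G = r * ip F G.
Proof.
move=> F2 G2; rewrite /ip -RintegralZl//; last exact: inL2_dot.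
by apply: eq_Rintegral => x _; rewrite dotZl.
Qed.

Lemma ipNl F G : inL2 F -> inL2 G -> ip (fun x => - F x) G = - ip F G.
Proof.
move=> F2 G2; rewrite -mulN1r -ipZl//; congr ip; apply/funext => x.
by rewrite rmorphN mulN1r.
Qed.

Lemma ipBl F G H : inL2 F -> inL2 G -> inL2 H ->
  ip (fun x => F x - G x) H = ip F H - ip G H.
Proof. by move=> F2 G2 H2; rewrite ipDl ?ipNl//; exact: inL2N. Qed.

Lemma ip0l G : ip (fun=> 0) G = 0.
Proof.
rewrite /ip (@eq_Rintegral _ _ _ _ _ (cst 0)); last by move=> x _;
  rewrite dot0l.
by rewrite Rintegral_cst// mul0r.
Qed.

Lemma ip_suml I (s : seq I) (P : pred I) (F : I -> R -> R[i]) G :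
  (forall i, inL2 (F i)) -> inL2 G ->
  ip (fun x => \sum_(i <- s | P i) F i x) G = \sum_(i <- s | P i) ip (F i) G.
Proof.
move=> F2 G2; elim: s => [|i s ih].
  by rewrite big_nil -(ip0l G); congr ip; apply/funext => x; rewrite big_nil.
rewrite big_cons -ih; have [Pi|Pi] := boolP (P i).
  rewrite -ipDl//; last exact: inL2_sum.
  by congr ip; apply/funext => x; rewrite big_cons Pi.
by congr ip; apply/funext => x; rewrite big_cons (negbTE Pi).
Qed.

Lemma ip_ge0 F : 0 <= ip F F.
Proof. by apply: Rintegral_ge0 => x _; exact: dot_ge0. Qed.

Definition sqnorm F := ip F F.

Lemma sqnormD F G : inL2 F -> inL2 G ->
  sqnorm (fun x => F x + G x) = sqnorm F + 2 * ip F G + sqnorm G.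
Proof.
move=> F2 G2; have FG := inL2D F2 G2;
  rewrite /sqnorm ipDl// ![ip _ (fun x => _ + _)]ipC !ipDl//.
by rewrite [ip G F]ipC; ring.
Qed.

Lemma sqnormZ z F : inL2 F -> sqnorm (fun x => z * F x) = dot z z * sqnorm F.
Proof.
move=> F2; rewrite /sqnorm /ip -RintegralZl//; last exact: inL2_dot.
by apply: eq_Rintegral => x _; rewrite dotM.
Qed.

Lemma sqnormN F : inL2 F -> sqnorm (fun x => - F x) = sqnorm F.
Proof.
move=> F2; rewrite -[RHS]mul1r -[in RHS](_ : dot (-1 : R[i]) (-1) = 1).
  by rewrite -sqnormZ//; congr sqnorm; apply/funext => x; rewrite mulN1r.
by rewrite /dot /=; ring.
Qed.

Lemma sqnormB F G : inL2 F -> inL2 G ->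
  sqnorm (fun x => F x - G x) = sqnorm F - 2 * ip F G + sqnorm G.
Proof.
move=> F2 G2; rewrite sqnormD//; last exact: inL2N.
by rewrite sqnormN// [ip F _]ipC ipNl// [ip G F]ipC; ring.
Qed.

Lemma sqnormD_le F G : inL2 F -> inL2 G ->
  sqnorm (fun x => F x + G x) <= 2 * sqnorm F + 2 * sqnorm G.
Proof.
move=> F2 G2; have := ip_ge0 (fun x => F x - G x).
by rewrite -/(sqnorm _) sqnormB// sqnormD//; lra.
Qed.

(** The squared norm of [B F - p G], with [p] the inner product and [B] the squared
norm of [G], is [B] times the difference of the two sides; the other cases
are needed when [B] vanishes, since null functions need not be zero. *)
Lemma cauchy_schwarz F G : inL2 F -> inL2 G ->
  ip F G ^+ 2 <= sqnorm F * sqnorm G.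
Proof.
move=> F2 G2; set p := ip F G; set A := sqnorm F; set B := sqnorm G.
have A0 : 0 <= A by exact: ip_ge0.
have B0 : 0 <= B by exact: ip_ge0.
have key (s t : R) : 0 <= s ^+ 2 * A - 2 * (s * t * p) + t ^+ 2 * B.
  have := ip_ge0 (fun x => s%:C%C * F x - t%:C%C * G x).
  rewrite -/(sqnorm _) sqnormB; try exact: inL2Z.
  rewrite !sqnormZ// ipZl//; last exact: inL2Z.
  rewrite [ip F _]ipC ipZl// [ip G F]ipC -/p -/A -/B /dot /=.
  by rewrite !mulr0 !addr0 -!expr2 !mulrA.
have [B_eq0|Bn0] := eqVneq B 0; last first.
  have Bp : 0 < B by rewrite lt_def Bn0.
  rewrite -subr_ge0 -(pmulr_rge0 _ Bp); apply: le_trans (key B p) _.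
  by rewrite le_eqVlt; apply/orP; left; apply/eqP; ring.
have [A_eq0|An0] := eqVneq A 0; last first.
  have Ap : 0 < A by rewrite lt_def An0.
  rewrite -subr_ge0 -(pmulr_rge0 _ Ap); apply: le_trans (key p A) _.
  by rewrite le_eqVlt; apply/orP; left; apply/eqP; ring.
rewrite A_eq0 mul0r.
have := key p 1; rewrite A_eq0 B_eq0; lra.
Qed.

Lemma inL2_integral F : inL2 F ->
  (\int[mu]_x (dot (F x) (F x))%:E = (sqnorm F)%:E)%E.
Proof.
move=> F2; rewrite /sqnorm /ip /Rintegral fineK//.
exact: integrable_fin_num (inL2_dot F2 F2).
Qed.

Lemma L2norm_integral F :
  (L2norm F = (\int[mu]_x (dot (F x) (F x))%:E) `^ 2^-1)%E.
Proof.
rewrite /L2norm unlock; congr (_ `^ _)%E; apply: eq_integral => x _ /=.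
by rewrite ger0_norm ?cmodulus_ge0// powR_mulrn ?cmodulus_ge0// cmodulus2.
Qed.

(** Relates the half power in the definition of the [L^2] norm to the integral of
the square; infinite values are included. *)
Lemma sqr_poweR_half (x : \bar R) : (0 <= x -> (x `^ 2^-1) ^+ 2 = x)%E.
Proof.
by move=> x0; rewrite poweR12_sqrt// sqr_sqrte.
Qed.

Lemma L2norm2 F : (L2norm F ^+ 2 = \int[mu]_x (dot (F x) (F x))%:E)%E.
Proof.
rewrite L2norm_integral sqr_poweR_half//.
by apply: integral_ge0 => x _; rewrite lee_fin dot_ge0.
Qed.

Lemma L2circle_inL2 F : L2circle F -> inL2 F.
Proof.
move=> [_ mr mi F2]; split => //; apply/integrableP; split.
  by apply/measurable_EFinP; apply: cmeasurable_dot.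
under eq_integral do rewrite gee0_abs ?lee_fin ?dot_ge0//.
have L0 : (0 <= L2norm F)%E by exact: Lnorm_ge0.
by rewrite -L2norm2 expe2 lte_mul_pinfty// ge0_fin_numE.
Qed.

End L2.

(** * Characters and trigonometric polynomials *)

Section CircleIntegral.
Context {R : realType}.
Local Notation mu := (@circle_measure R).
Local Notation leb := (@lebesgue_measure R).

Lemma circle_measureC01 : mu (~` `[0, 1]) = 0%E.
Proof. by rewrite /circle_measure /= /mrestr setICl measure0. Qed.

(** Lets integrals over the circle be computed with Lebesgue measure. *)
Lemma circle_measure_sub A : A `<=` `[0, 1] -> mu A = leb A.
Proof. by move=> A01; rewrite /circle_measure /= /mrestr setIidl. Qed.

Lemma ge0_circle_integral (f : R -> \bar R) :
  measurable_fun setT f -> (forall x, (0 <= f x)%E) ->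
  (\int[mu]_x f x = \int[leb]_(x in `[0%R, 1%R]) f x)%E.
Proof.
move=> mf f0.
rewrite (@ge0_negligible_integral _ _ _ mu setT (~` `[0, 1]))
  ?circle_measureC01//; last exact: measurableC.
rewrite setDE setTI setCK (eq_measure_integral leb)// => A mA A01.
exact: circle_measure_sub.
Qed.

Lemma circle_integral (f : R -> \bar R) :
  mu.-integrable setT f ->
  (\int[mu]_x f x = \int[leb]_(x in `[0%R, 1%R]) f x)%E.
Proof.
move=> mf.
rewrite (@negligible_integral _ _ _ mu setT (~` `[0, 1])) ?circle_measureC01//;
  last exact: measurableC.
rewrite setDE setTI setCK (eq_measure_integral leb)// => A mA A01.
exact: circle_measure_sub.
Qed.

End CircleIntegral.

Section Characters.
Context {R : realType}.
Local Notation mu := (@circle_measure R).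
Local Notation e := (@character R).
Implicit Types (m n : int) (z w : R[i]) (x : R).

Lemma character_add m n x : e (m + n) x = e m x * e n x.
Proof.
rewrite /character rmorphD /= mulrDr mulrDl cosD sinD.
by apply/eqP; rewrite eq_complex /= [X in _ && (_ == X)]addrC !eqxx.
Qed.

Lemma character_dilate m (k : nat) x : e m (k%:R * x) = e (m * k%:Z) x.
Proof. by rewrite /character intrM -!pmulrn !mulrA. Qed.

Lemma character0 x : e 0 x = 1.
Proof. by rewrite /character mulr0 mul0r cos0 sin0. Qed.

(** The product of one character with the conjugate of another is again a
character, of frequency [m - n]; this reduces orthogonality to the integrals of
one cosine and one sine. *)
Lemma dot_character z w m n x : dot (z * e m x) (w * e n x) =
  dot z w * cos (2 * pi * (m - n)%:~R * x) +
  (complex.Re z * complex.Im w - complex.Im z * complex.Re w) *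
    sin (2 * pi * (m - n)%:~R * x).
Proof.
rewrite rmorphB /= mulrBr mulrBl cosB sinB /character.
by case: z => a b; case: w => c d; rewrite /dot /=; ring.
Qed.

Lemma continuous_scale (c : R) : continuous (fun x : R => c * x).
Proof. by move=> x; apply: cvgM; [exact: cvg_cst|exact: cvg_id]. Qed.

Lemma continuous_cos_scale (c : R) : continuous (fun x : R => cos (c * x)).
Proof.
move=> x; apply: continuous_comp;
  [exact: continuous_scale|exact: continuous_cos].
Qed.

Lemma continuous_sin_scale (c : R) : continuous (fun x : R => sin (c * x)).
Proof.
move=> x; apply: continuous_comp;
  [exact: continuous_scale|exact: continuous_sin].
Qed.

Lemma measurable_cos_scale (c : R) :
  measurable_fun setT (fun x : R => cos (c * x)).
Proof. apply: continuous_measurable_fun; exact: continuous_cos_scale. Qed.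

Lemma measurable_sin_scale (c : R) :
  measurable_fun setT (fun x : R => sin (c * x)).
Proof. apply: continuous_measurable_fun; exact: continuous_sin_scale. Qed.

Lemma bounded_circle_integrable (g : R -> R) (C : R) : measurable_fun setT g ->
  (forall x, `|g x| <= C) -> mu.-integrable setT (fun x => (g x)%:E).
Proof.
move=> mg gC.
apply: (@le_integrable _ _ _ mu _ measurableT _ (cst C%:E)).
- exact/measurable_EFinP.
- by move=> x _ /=; rewrite lee_fin (le_trans (gC x))// ler_norm.
- apply/integrableP; split; first exact: measurable_cst.
  under eq_integral do rewrite /=.
  by rewrite integral_cst// circle_measureT mule1 ltry.
Qed.

Lemma is_derive_scale (c x : R) : is_derive x 1 (fun x : R => c * x) c.
Proof. by apply: is_derive_eq; rewrite -[LHS]/(c * 1) mulr1. Qed.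

Lemma is_derive_sin_scale (c x : R) :
  is_derive x 1 (fun x => sin (c * x)) (c * cos (c * x)).
Proof.
by rewrite mulrC; exact: (is_derive1_comp (is_derive_sin (c * x))
  (is_derive_scale c x)).
Qed.

Lemma is_derive_cos_scale (c x : R) :
  is_derive x 1 (fun x => cos (c * x)) (- (c * sin (c * x))).
Proof.
by rewrite mulrC -mulNr;
  exact: (is_derive1_comp (is_derive_cos (c * x)) (is_derive_scale c x)).
Qed.

Lemma circle_integral_derivative (F f : R -> R) (C : R) : continuous f ->
  (forall x, `|f x| <= C) -> (forall x, is_derive x 1 F (f x)) ->
  Rintegral mu setT f = F 1 - F 0.
Proof.
move=> cf fC dF.
have cF : continuous F.
  by move=> x; apply/differentiable_continuous/derivable1_diffP; case: (dF x).
rewrite /Rintegral circle_integral; last first.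
  by apply: (@bounded_circle_integrable _ C) => //;
    exact: continuous_measurable_fun.
rewrite (@continuous_FTC2 _ f F 0 1)//.
- by apply: continuous_in_subspaceT => x _; exact: cf.
- split.
  + by move=> x _; case: (dF x).
  + by apply: cvg_at_right_filter; exact: cF.
  + by apply: cvg_at_left_filter; exact: cF.
- by move=> x _; rewrite derive1E; case: (dF x).
Qed.

Lemma sin_cos_2pin n :
  sin (2 * pi * n%:~R) = 0 :> R /\ cos (2 * pi * n%:~R) = 1 :> R.
Proof.
have hn (k : nat) :
    sin (2 * pi * k%:R) = 0 :> R /\ cos (2 * pi * k%:R) = 1 :> R.
  have -> : 2 * pi * k%:R = 0 + (pi *+ 2) *+ k :> R.
    by rewrite add0r -[RHS]mulr_natr -[pi *+ 2]mulr_natl.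
  by rewrite (periodicn (@sinD2pi R)) (periodicn (@cosD2pi R)) sin0 cos0.
case: n => k; first by rewrite -pmulrn; exact: hn.
by rewrite NegzE intrN mulrN sinN cosN; have [-> ->] := hn k.+1; rewrite oppr0.
Qed.

Lemma circle_integral_cos n : n != 0 ->
  Rintegral mu setT (fun x : R => cos (2 * pi * n%:~R * x)) = 0.
Proof.
move=> n0; set c := 2 * pi * n%:~R.
have c0 : c != 0 by rewrite !mulf_neq0// ?intr_eq0// gt_eqF ?pi_gt0.
suff : c * Rintegral mu setT (fun x : R => cos (c * x)) = 0.
  by move=> /eqP; rewrite mulf_eq0 (negbTE c0) => /eqP.
rewrite -RintegralZl//; last first.
  apply: (@bounded_circle_integrable _ 1) => [|x]; last exact: cos_max.
  exact: measurable_cos_scale.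
have cf : continuous (fun x : R => c * cos (c * x)).
  by move=> x; apply: cvgM; [exact: cvg_cst|exact: continuous_cos_scale].
have bf x : `|c * cos (c * x)| <= `|c| by rewrite normrM ler_piMr// cos_max.
rewrite (circle_integral_derivative cf bf (is_derive_sin_scale c)).
by rewrite mulr0 sin0 subr0 mulr1 (sin_cos_2pin n).1.
Qed.

Lemma circle_integral_sin n :
  Rintegral mu setT (fun x : R => sin (2 * pi * n%:~R * x)) = 0.
Proof.
have [->|n0] := eqVneq n 0.
  rewrite (@eq_Rintegral _ _ _ _ _ (cst 0));
    first by rewrite Rintegral_cst// mul0r.
  by move=> x _; rewrite mulr0 mul0r sin0.
set c := 2 * pi * n%:~R.
have c0 : c != 0 by rewrite !mulf_neq0// ?intr_eq0// gt_eqF ?pi_gt0.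
suff : - c * Rintegral mu setT (fun x : R => sin (c * x)) = 0.
  by move=> /eqP; rewrite mulf_eq0 oppr_eq0 (negbTE c0) => /eqP.
rewrite -RintegralZl//; last first.
  apply: (@bounded_circle_integrable _ 1) => [|x]; last exact: sin_max.
  exact: measurable_sin_scale.
have cf : continuous (fun x : R => - c * sin (c * x)).
  by move=> x; apply: cvgM; [exact: cvg_cst|exact: continuous_sin_scale].
have bf x : `|- c * sin (c * x)| <= `|c| by rewrite normrM normrN ler_piMr//
  sin_max.
have df x : is_derive x 1 (fun x => cos (c * x)) (- c * sin (c * x)).
  by rewrite mulNr; exact: is_derive_cos_scale.
rewrite (circle_integral_derivative cf bf df).
by rewrite mulr0 cos0 mulr1 (sin_cos_2pin n).2 subrr.
Qed.

(** Trigonometric polynomials are kept as lists of pairs (frequency, coefficient) in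
which frequencies may be repeated: sums, products and dilations are then plain
list operations. *)
Definition trig (s : seq (int * R[i])) : R -> R[i] :=
  fun x => \sum_(p <- s) p.2 * e p.1 x.

Lemma inL2_character z n : inL2 (fun x => z * e n x).
Proof.
apply: inL2Z; apply: (@inL2_bounded _ _ 1); last first.
  by move=> x; rewrite /dot /= -!expr2 cos2Dsin2.
by split; [exact: measurable_cos_scale|exact: measurable_sin_scale].
Qed.

Lemma inL2_trig s : inL2 (trig s).
Proof. by apply: inL2_sum => p; exact: inL2_character. Qed.

Lemma ip_character z w m n :
  ip (fun x => z * e m x) (fun x => w * e n x) = (m == n)%:R * dot z w.
Proof.
rewrite /ip; under eq_Rintegral do rewrite dot_character.
rewrite RintegralD//; last 2 first.
- apply: (@bounded_circle_integrable _ (`|dot z w|)).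
    by apply: measurable_funM => //; exact: measurable_cos_scale.
  by move=> x; rewrite normrM ler_piMr// cos_max.
- apply: (@bounded_circle_integrable _
    (`|complex.Re z * complex.Im w - complex.Im z * complex.Re w|)).
    by apply: measurable_funM => //; exact: measurable_sin_scale.
  by move=> x; rewrite normrM ler_piMr// sin_max.
rewrite !RintegralZl//; last 2 first.
- by apply: (@bounded_circle_integrable _ 1) => [|x];
    [exact: measurable_sin_scale|exact: sin_max].
- by apply: (@bounded_circle_integrable _ 1) => [|x];
    [exact: measurable_cos_scale|exact: cos_max].
rewrite circle_integral_sin mulr0 addr0.
have [->|mn] := eqVneq m n;
  last by rewrite circle_integral_cos ?subr_eq0// mulr0 mul0r.
rewrite (@eq_Rintegral _ _ _ _ _ (cst 1)); last by move=> x _;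
  rewrite subrr mulr0 mul0r cos0.
by rewrite Rintegral_cst// circle_measureT /= !mul1r mulr1.
Qed.

Lemma ip_trigr F s : inL2 F ->
  ip F (trig s) = \sum_(p <- s) ip F (fun x => p.2 * e p.1 x).
Proof.
move=> F2; rewrite ipC ip_suml//; last by move=> p; exact: inL2_character.
by apply: eq_bigr => p _; rewrite ipC.
Qed.

Lemma ip_trig s t : ip (trig s) (trig t) =
  \sum_(p <- s) \sum_(q <- t) (p.1 == q.1)%:R * dot p.2 q.2.
Proof.
rewrite ip_suml; [|by move=> p; exact: inL2_character|exact: inL2_trig].
apply: eq_bigr => p _; rewrite ip_trigr; last exact: inL2_character.
by apply: eq_bigr => q _; rewrite ip_character.
Qed.

(** The Hermitian coefficient is determined by real inner products: [z = 1] gives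
its real part and [z = i] its imaginary part. *)
Lemma ip_fourier_coef F z n : inL2 F ->
  ip F (fun x => z * e n x) = dot z (fourier_coef F n).
Proof.
move=> F2; rewrite /dot /fourier_coef /Cintegral /=.
have E2 : inL2 (e n).
  by rewrite (_ : e n = fun x => 1 * e n x);
    [exact: inL2_character|apply/funext => x; rewrite mul1r].
have iE2 : inL2 (fun x => 'i%C * e n x) by exact: inL2Z.
have -> : (\int[mu]_x complex.Re (F x * e (- n) x))%R = ip F (e n).
  apply: eq_Rintegral => x _; rewrite /character intrN mulrN mulNr cosN sinN.
  by case: (F x) => a b; rewrite /dot /= mulrN opprK.
have -> : (\int[mu]_x complex.Im (F x * e (- n) x))%R =
  ip F (fun x => 'i%C * e n x).
  apply: eq_Rintegral => x _; rewrite /character intrN mulrN mulNr cosN sinN.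
  by case: (F x) => a b; rewrite /dot /=; ring.
rewrite ![ip F _]ipC -!ipZl// -ipDl//; try exact: inL2Z.
congr ip; apply/funext => x; rewrite mulrA -mulrDl; congr (_ * _).
by case: z => a b; apply/eqP; rewrite eq_complex /=; apply/andP; split;
  apply/eqP; ring.
Qed.

Lemma trig_cat s t x : trig (s ++ t) x = trig s x + trig t x.
Proof. by rewrite /trig big_cat. Qed.

Lemma trig_opp s x : trig [seq (p.1, - p.2) | p <- s] x = - trig s x.
Proof.
by rewrite /trig big_map -sumrN; apply: eq_bigr => p _; rewrite mulNr.
Qed.

Lemma trig_mul s t x :
  trig [seq (p.1 + q.1, p.2 * q.2) | p <- s, q <- t] x = trig s x * trig t x.
Proof.
rewrite /trig big_allpairs_dep mulr_suml; apply: eq_bigr => p _.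
by rewrite mulr_sumr; apply: eq_bigr => q _; rewrite character_add mulrACA.
Qed.

Lemma trig_scale z s x : trig [seq (p.1, z * p.2) | p <- s] x = z * trig s x.
Proof.
by rewrite /trig big_map mulr_sumr; apply: eq_bigr => p _; rewrite mulrA.
Qed.

Lemma trig_dilate s (k : nat) x :
  trig s (k%:R * x) = trig [seq (p.1 * k%:Z, p.2) | p <- s] x.
Proof.
by rewrite /trig big_map; apply: eq_bigr => p _; rewrite character_dilate.
Qed.

End Characters.

(** * Density of the trigonometric polynomials *)

Section Bernoulli.
Context {R : realType}.

Lemma bernoulli_inequality (x : R) (n : nat) : -1 <= x ->
  1 + n%:R * x <= (1 + x) ^+ n.
Proof.
move=> x1; elim: n => [|n ih]; first by rewrite mul0r addr0 expr0.
rewrite exprS -natr1.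
have h : 0 <= 1 + x by lra.
apply: le_trans (ler_wpM2l h ih).
have := mulr_ge0 (ler0n R n) (sqr_ge0 x).
rewrite expr2; nra.
Qed.

(** Both cases come from Bernoulli's inequality.  If [Kp < 1], then
[(1 - p^m)^(K^m) >= 1 - (Kp)^m]; if [Kp > 1], put [q = p^m], [n = K^m]: from
[(1 - q)^n (1 + nq) <= (1 - q^2)^n <= 1] the power is at most [(Kp)^(-m)]. *)
Lemma power_threshold (p : R) (K : nat) : 0 <= p <= 1 -> K%:R * p != 1 ->
  (1 - p ^+ m) ^+ (K ^ m)%N @[m --> \oo] --> (((K%:R * p < 1)%R)%:R : R).
Proof.
move=> /andP[p0 p1] Kp1.
have q0 m : 0 <= p ^+ m by rewrite exprn_ge0.
have q1 m : p ^+ m <= 1 by rewrite exprn_ile1.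
have Kpm m : (K ^ m)%:R * p ^+ m = (K%:R * p) ^+ m by rewrite natrX exprMn.
case: ltP => [Kplt|Kpge].
- have r0 : `|K%:R * p| < 1 by rewrite ger0_norm// mulr_ge0.
  apply: (@squeeze_cvgr _ _ _ _ (fun m => 1 - geometric 1 (K%:R * p) m)
    (cst 1)).
  + near=> m; rewrite exprn_ile1 ?subr_ge0// ?gerBl//
      andbT /geometric /= mul1r -Kpm.
    rewrite -mulrN; apply: bernoulli_inequality; rewrite lerN2; exact: q1.
  + by rewrite -[X in _ --> X]subr0; apply: cvgB;
      [exact: cvg_cst|exact: cvg_geometric].
  + exact: cvg_cst.
- have {Kp1 Kpge}Kp1 : 1 < K%:R * p by rewrite lt_def Kp1.
  have r0 : `|(K%:R * p)^-1| < 1.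
    by rewrite ger0_norm ?invr_ge0 ?(le_trans ler01 (ltW Kp1))// invf_lt1//
      (lt_trans ltr01).
  apply: (@squeeze_cvgr _ _ _ _ (cst 0) (fun m => geometric 1 (K%:R * p)^-1 m)).
  + near=> m; rewrite exprn_ge0 ?subr_ge0//= mul1r exprVn -Kpm.
    set q := p ^+ m; set N := (K ^ m)%N.
    have qq0 : 0 <= q := q0 m.
    have qq1 : q <= 1 := q1 m.
    have Nq : 0 < N%:R * q by rewrite Kpm exprn_gt0// (lt_trans ltr01).
    rewrite -[leRHS]mul1r ler_pdivlMr//.
    have h : (1 - q) ^+ N * (1 + q) ^+ N <= 1.
      rewrite -exprMn -subr_sqr expr1n exprn_ile1// ?gerBl ?sqr_ge0//.
      by rewrite subr_ge0 exprn_ile1.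
    apply: le_trans h; apply: ler_wpM2l; first by rewrite exprn_ge0// subr_ge0.
    apply: le_trans (bernoulli_inequality _ _); first by rewrite lerDr.
    by rewrite (le_trans _ qq0)// lerN10.
  + exact: cvg_cst.
  + exact: cvg_geometric.
Unshelve. all: by end_near.
Qed.

End Bernoulli.

Section Density.
Context {R : realType}.
Local Notation mu := (@circle_measure R).
Implicit Types (F G : R -> R[i]) (g h : R -> R).

(** The closure of the trigonometric polynomials in [L^2]. *)
Definition trig_dense F :=
  inL2 F /\ forall eps : R, 0 < eps ->
    exists s, sqnorm (fun x => F x - trig s x) <= eps.

Lemma trig_dense_trig s : trig_dense (trig s).
Proof.
split; first exact: inL2_trig.
move=> eps eps0; exists s; rewrite (_ : (fun x => _) = fun=> 0).
  by rewrite /sqnorm ip0l ltW.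
by apply/funext => x; rewrite subrr.
Qed.

Lemma trig_denseD F G : trig_dense F -> trig_dense G ->
  trig_dense (fun x => F x + G x).
Proof.
move=> [F2 dF] [G2 dG]; split; first exact: inL2D.
move=> eps eps0.
have [s Fs] := dF (eps / 4) (divr_gt0 eps0 (ltr0n _ 4)).
have [t Gt] := dG (eps / 4) (divr_gt0 eps0 (ltr0n _ 4)).
exists (s ++ t).
rewrite (_ : (fun x => _) = fun x => (F x - trig s x) + (G x - trig t x)).
  apply: le_trans (sqnormD_le _ _) _; [| |lra]; by apply: inL2B => //;
    exact: inL2_trig.
by apply/funext => x; rewrite trig_cat opprD addrACA.
Qed.

Lemma trig_denseZ z F : trig_dense F -> trig_dense (fun x => z * F x).
Proof.
move=> [F2 dF]; split; first exact: inL2Z.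
move=> eps eps0.
have d0 : 0 < dot z z + 1 by rewrite ltr_wpDl// dot_ge0.
have [s Fs] := dF (eps / (dot z z + 1)) (divr_gt0 eps0 d0).
exists [seq (p.1, z * p.2) | p <- s].
rewrite (_ : (fun x => _) = fun x => z * (F x - trig s x)).
  rewrite sqnormZ; last by apply: inL2B => //; exact: inL2_trig.
  apply: le_trans (ler_wpM2l (dot_ge0 z) Fs) _.
  by rewrite mulrCA ler_piMr ?(ltW eps0)// ler_pdivrMr// mul1r lerDl.
by apply/funext => x; rewrite trig_scale mulrBr.
Qed.

Lemma trig_dense_sum n (F : 'I_n -> R -> R[i]) :
  (forall i, trig_dense (F i)) -> trig_dense (fun x => \sum_i F i x).
Proof.
elim: n F => [|n ih] F dF.
  rewrite (_ : (fun x => _) = trig [::]); first exact: trig_dense_trig.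
  by apply/funext => x; rewrite big_ord0 /trig big_nil.
rewrite (_ : (fun x => _) = fun x => F ord0 x + \sum_i F (lift ord0 i) x).
  by apply: trig_denseD => //; exact: ih.
by apply/funext => x; rewrite big_ord_recl.
Qed.

Lemma trig_dense_closed F : inL2 F ->
  (forall eps : R, 0 < eps ->
    exists2 G, trig_dense G & sqnorm (fun x => F x - G x) <= eps) ->
  trig_dense F.
Proof.
move=> F2 dF; split => // eps eps0.
have [G [G2 dG] FG] := dF (eps / 4) (divr_gt0 eps0 (ltr0n _ 4)).
have [t Gt] := dG (eps / 4) (divr_gt0 eps0 (ltr0n _ 4)).
exists t; rewrite (_ : (fun x => _) = fun x => (F x - G x) + (G x - trig t x)).
  apply: le_trans (sqnormD_le _ _) _; [exact: inL2B| |lra].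
  by apply: inL2B => //; exact: inL2_trig.
by apply/funext => x; rewrite subrKA.
Qed.

Definition complexify (g : R -> R) : R -> R[i] := fun x => (g x)%:C%C.

Lemma dot_complexify g h x : dot (complexify g x) (complexify h x) = g x * h x.
Proof. by rewrite /dot /= mulr0 addr0. Qed.

Lemma cmeasurable_complexify g : measurable_fun setT g ->
  cmeasurable (complexify g).
Proof. by move=> mg; split => //=. Qed.

Lemma inL2_complexify g h : measurable_fun setT g ->
  mu.-integrable setT (EFin \o h) ->
  (forall x, g x ^+ 2 <= h x) -> inL2 (complexify g).
Proof.
move=> mg ih gh; split; first exact: cmeasurable_complexify.
apply: le_integrable ih => //.
  by apply/measurable_EFinP; apply: cmeasurable_dot;
    exact: cmeasurable_complexify.
move=> x _; rewrite dot_complexify -expr2 /= lee_fin ger0_norm ?sqr_ge0//.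
by rewrite (le_trans (gh x))// ler_norm.
Qed.

(** The form in which closedness is used: pointwise almost everywhere limits of real
functions whose squares have a common integrable bound. *)
Lemma trig_dense_dominated (g_ : nat -> R -> R) g h :
  (forall n, trig_dense (complexify (g_ n))) -> measurable_fun setT g ->
  {ae mu, forall x, g_ n x @[n --> \oo] --> g x} ->
  mu.-integrable setT (EFin \o h) ->
  (forall n x, g_ n x ^+ 2 <= h x) -> (forall x, g x ^+ 2 <= h x) ->
  trig_dense (complexify g).
Proof.
move=> dg mg cg ih gnh gh.
have g2 := inL2_complexify mg ih gh.
apply: trig_dense_closed => // eps eps0.
have mgn n : measurable_fun setT (g_ n) by case: (dg n) => -[[]].
pose d n x := (g_ n x - g x) ^+ 2.
have md n : measurable_fun setT (d n) by apply: measurable_funX;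
  exact: measurable_funB.
have dle n x : d n x <= 4 * h x.
  have := gnh n x; have := gh x; rewrite /d => h1 h2;
    have := sqr_ge0 (g_ n x + g x); nra.
have cd : {ae mu, forall x, setT x ->
  (d n x)%:E @[n --> \oo] --> (cst 0%E : R -> \bar R) x}.
  case: cg => N [mN N0 sN]; exists N; split => // x /= nx; apply: sN => /= cx;
    apply: nx => _.
  apply: cvg_EFin; first exact: nearW.
  rewrite /= (_ : 0 = (g x - g x) * (g x - g x)); last by rewrite subrr mul0r.
  by apply: cvgM; apply: cvgB => //; exact: cvg_cst.
have id4 : mu.-integrable setT (fun x => (4 * h x)%:E).
  by under eq_fun do rewrite EFinM; exact: integrableZl.
have bd : {ae mu, forall x n, setT x -> (`|(d n x)%:E| <= (4 * h x)%:E)%E}.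
  by apply: nearW => x n _; rewrite lee_fin ger0_norm ?sqr_ge0.
have [_ _ +] := @dominated_convergence _ _ _ mu setT measurableT
  (fun n x => (d n x)%:E) (cst 0%E) (fun x => (4 * h x)%:E)
  (fun n => (measurable_EFinP _ _).2 (md n)) (measurable_cst _) cd id4 bd.
rewrite integral0 => /fine_cvgP[_] /cvgrPdist_le /(_ eps eps0)
  [n _ /(_ n (leqnn n))] /=.
rewrite sub0r normrN => hn; exists (complexify (g_ n)) => //.
apply: le_trans hn; rewrite le_eqVlt; apply/orP; left; apply/eqP.
rewrite ger0_norm ?fine_ge0 ?integral_ge0//; last first.
  by move=> x _; rewrite lee_fin sqr_ge0.
rewrite /sqnorm /ip /Rintegral; congr fine; apply: eq_integral => x _.
by rewrite /d /complexify -rmorphB /dot /= mulr0 addr0 -expr2 -sqrrN opprB.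
Qed.

(** Points of the line outside the unit interval, its end points and one further
point are negligible for the circle. *)
Lemma ae_circle (P : R -> Prop) b :
  (forall x, 0 < x < 1 -> x != b -> P x) -> {ae mu, forall x, P x}.
Proof.
move=> hP.
have m1 (r : R) : mu.-negligible [set r].
  apply/negligibleP; first exact: measurable_set1.
  apply/eqP; rewrite eq_le measure_ge0 andbT.
  rewrite -[leRHS](lebesgue_measure_set1 r) /circle_measure /= /mrestr.
  apply: le_measure; rewrite ?inE; [|exact: measurable_set1|exact: subIsetl].
  by apply: measurableI; [exact: measurable_set1|exact: measurable_itv].
have m01 : mu.-negligible (~` `[0, 1]).
  by apply/negligibleP; [apply: measurableC;
    exact: measurable_itv|exact: circle_measureC01].
have [N [mN N0 sN]] := negligibleU (negligibleU (negligibleU m01 (m1 0))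
  (m1 1)) (m1 b).
exists N; split => // x nP; apply: sN; apply: contrapT => nx.
have {}nP : ~ P x by [].
apply: nP; apply: hP.
    have x01 : x \in `[0, 1] by apply: contrapT => h; apply: nx; left; left;
      left.
    move: x01; rewrite in_itv/= !le_eqVlt => /andP[/orP[/eqP x0|->] /orP[/eqP
      x1|->]]//.
    + by exfalso; apply: nx; left; left; right.
    + by exfalso; apply: nx; left; left; right.
    + by exfalso; apply: nx; left; right.
  by apply/eqP => xb; apply: nx; right.
Qed.

Definition is_trig F := exists s, F = trig s.

Lemma is_trig_dense F : is_trig F -> trig_dense F.
Proof. by move=> [s ->]; exact: trig_dense_trig. Qed.

Lemma is_trig_cst z : is_trig (fun=> z).
Proof.
exists [:: (0, z)]; apply/funext => x.
by rewrite /trig big_seq1 character0 mulr1.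
Qed.

Lemma is_trigD F G : is_trig F -> is_trig G -> is_trig (fun x => F x + G x).
Proof.
by move=> [s ->] [t ->]; exists (s ++ t); apply/funext => x; rewrite trig_cat.
Qed.

Lemma is_trigM F G : is_trig F -> is_trig G -> is_trig (fun x => F x * G x).
Proof.
move=> [s ->] [t ->]; exists [seq (p.1 + q.1, p.2 * q.2) | p <- s, q <- t].
by apply/funext => x; rewrite trig_mul.
Qed.

Lemma is_trigX F n : is_trig F -> is_trig (fun x => F x ^+ n).
Proof.
move=> tF; elim: n => [|n ih]; first exact: is_trig_cst.
by under eq_fun do rewrite exprS; exact: is_trigM.
Qed.

Lemma is_trig_cos (t : R) :
  is_trig (complexify (fun x => cos (2 * pi * x - t))).
Proof.
exists [:: (1, (cos t / 2) -i* (sin t / 2));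
  (- 1, (cos t / 2) +i* (sin t / 2))]%C.
apply/funext => x; rewrite /trig !big_cons big_nil /= addr0 /character
  /complexify.
rewrite intrN mulrN mulr1 mulNr cosN sinN cosB.
by apply/eqP; rewrite eq_complex /=; apply/andP; split; apply/eqP; field.
Qed.

(** On the unit interval the half-line is the arc from [0] to [b], where
[cos(2 pi x - pi b)] exceeds [cos(pi b)].  A multiple [p] of
[1 + cos(2 pi x - pi b)] that passes the level [1/K] at the end points of this arc
turns [power_threshold] into an approximation of the indicator. *)
Lemma trig_dense_ray01 b : 0 < b < 1 ->
  trig_dense (complexify (\1_(`]-oo, b[) : R -> R)).
Proof.
move=> /andP[b0 b1].
have pi0 := pi_gt0 R.
have cb : 0 < 1 + cos (pi * b).
  rewrite -ltrBlDl sub0r -cospi ltr_cos ?in_itv/= ?pi_ge0 ?lexx ?andbT//.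
    by rewrite gtr_pMr.
  by rewrite mulr_ge0 ?(ltW pi0) ?(ltW b0)//= ger_pMr// ltW.
(* K is large enough for the normalization c of the cosine to be at most 1,
   which keeps p in [0,1]. *)
pose K := (Num.truncn (2 / (1 + cos (pi * b)))).+1.
have Kgt : 2 / (1 + cos (pi * b)) < K%:R by exact: truncnS_gt.
have K0 : 0 < K%:R :> R by rewrite ltr0n.
pose c : R := 2 / (K%:R * (1 + cos (pi * b))).
have c0 : 0 < c by rewrite divr_gt0// mulr_gt0.
have c1 : c <= 1.
  rewrite /c ler_pdivrMr ?mulr_gt0// mul1r -ler_pdivrMr//; exact: ltW.
pose p x := c * (1 + cos (2 * pi * x - pi * b)) / 2.
have cos1 (y : R) : 0 <= 1 + cos y <= 2 by have := cos_geN1 y;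
  have := cos_le1 y; lra.
have p0 x : 0 <= p x.
  by rewrite /p divr_ge0// mulr_ge0 ?(ltW c0)//;
    case/andP: (cos1 (2 * pi * x - pi * b)).
have p1 x : p x <= 1.
  rewrite /p ler_pdivrMr// mul1r -[leRHS]mul1r.
  by case/andP: (cos1 (2 * pi * x - pi * b)) => ? ?; rewrite ler_pM ?(ltW c0).
(* The sign of cos(2 pi x - pi b) - cos(pi b) = 2 sin(pi x) sin(pi (b - x)) decides
   on which side of b the point x lies. *)
have Kp x : K%:R * p x - 1 =
  2 * sin (pi * x) * sin (pi * (b - x)) / (1 + cos (pi * b)).
  have -> : 2 * sin (pi * x) * sin (pi * (b - x)) =
    cos (2 * pi * x - pi * b) - cos (pi * b).
    have -> : 2 * pi * x - pi * b = pi * x - pi * (b - x) by ring.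
    have -> : cos (pi * b) = cos (pi * x + pi * (b - x)) by congr cos; ring.
    by rewrite cosB cosD; ring.
  by rewrite /p /c; field; rewrite !gt_eqF.
have tp : is_trig (complexify p).
  rewrite (_ : complexify p =
    fun x => (c / 2)%:C%C *
      (1 + complexify (fun x => cos (2 * pi * x - pi * b)) x)).
    by apply: is_trigM; [exact: is_trig_cst|apply: is_trigD;
      [exact: is_trig_cst|exact: is_trig_cos]].
  by apply/funext => x; rewrite /complexify -(rmorph1 (real_complex R))
    -rmorphD -rmorphM; congr (_%:C%C); rewrite /p; ring.
apply: (@trig_dense_dominated (fun m x => 1 - (1 - p x ^+ m) ^+ (K ^ m)%N) _
  (cst 1)).
- move=> m; apply: is_trig_dense.
  rewrite (_ : complexify _ =
    fun x => 1 + (-1) * ((1 + (-1) * (complexify p x) ^+ m) ^+ (K ^ m)%N)).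
    apply: is_trigD; first exact: is_trig_cst.
    apply: is_trigM; first exact: is_trig_cst.
    apply: is_trigX; apply: is_trigD; first exact: is_trig_cst.
    apply: is_trigM; first exact: is_trig_cst.
    exact: is_trigX.
  by apply/funext => x; rewrite /complexify !mulN1r rmorphB rmorph1 rmorphXn
    rmorphB rmorph1 rmorphXn.
- by apply: measurable_indic; exact: measurable_itv.
- apply: (@ae_circle _ b) => x /andP[x0 x1] xb.
  have sx : 0 < sin (pi * x) by rewrite sin_gt0_pi// mulr_gt0//= gtr_pMr.
  have [xltb|bltx] := ltP x b.
    have s0 : 0 < sin (pi * (b - x)).
      rewrite sin_gt0_pi// mulr_gt0 ?subr_gt0//= gtr_pMr//.
      by rewrite (lt_trans _ b1)// ltrBlDr ltrDl.
    have Kp1 : 1 < K%:R * p x by rewrite -subr_gt0 Kp divr_gt0// !mulr_gt0.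
    rewrite indicE mem_set; last by rewrite /= in_itv.
    rewrite -[X in _ --> X]subr0; apply: cvgB; first exact: cvg_cst.
    have := @power_threshold _ (p x) K; rewrite p0 p1 gt_eqF// (lt_gtF Kp1);
      exact.
  have {bltx}bltx : b < x by rewrite lt_def xb.
  have s0 : 0 < sin (pi * (x - b)).
    rewrite sin_gt0_pi// mulr_gt0 ?subr_gt0//= gtr_pMr//.
    by rewrite (lt_trans _ x1)// ltrBlDr ltrDl.
  have Kp1 : K%:R * p x < 1.
    rewrite -subr_lt0 Kp -opprB mulrN sinN mulrN mulNr oppr_lt0 divr_gt0//
      !mulr_gt0//.
  rewrite indicE memNset; last by rewrite /= in_itv/=; apply/negP;
    rewrite -leNgt ltW.
  rewrite -[X in _ --> X](subrr 1); apply: cvgB; first exact: cvg_cst.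
  have := @power_threshold _ (p x) K; rewrite p0 p1 lt_eqF// Kp1; exact.
- by apply: (@bounded_circle_integrable _ _ 1) => // x; rewrite normr1.
- move=> m x; set y := (1 - p x ^+ m) ^+ _.
  have y0 : 0 <= y by rewrite exprn_ge0// subr_ge0 exprn_ile1.
  have y1 : y <= 1 by rewrite exprn_ile1// ?subr_ge0 ?exprn_ile1//
    gerBl exprn_ge0.
  by rewrite /= expr_le1// ?subr_ge0// gerBl.
- by move=> x; rewrite indicE /=; case: (_ \in _);
    rewrite /= ?expr1n// expr0n/= ler01.
Qed.

Lemma sqr_indic_le1 (A : set R) x : (\1_A x : R) ^+ 2 <= 1.
Proof. by rewrite indicE; case: (_ \in _); rewrite ?expr1n// expr0n ler01. Qed.

Lemma integrable_cst1 : mu.-integrable setT (EFin \o (cst 1 : R -> R)).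
Proof.
by apply: (@bounded_circle_integrable _ _ 1) => // x; rewrite normr1.
Qed.

Lemma trig_dense_cst (r : R) : trig_dense (complexify (cst r)).
Proof. exact: is_trig_dense (is_trig_cst r%:C%C). Qed.

Lemma trig_dense_ray b : trig_dense (complexify (\1_(`]-oo, b[) : R -> R)).
Proof.
have mray : measurable_fun setT (\1_(`]-oo, b[) : R -> R).
  by apply: measurable_indic; exact: measurable_itv.
have [b0|b0] := leP b 0.
  apply: (@trig_dense_dominated (fun=> cst 0) _ (cst 1)) => //.
  - by move=> _; exact: trig_dense_cst.
  - apply: (@ae_circle _ b) => x /andP[x0 x1] xb.
    rewrite indicE memNset; first exact: cvg_cst.
    by rewrite /= in_itv/=; apply/negP; rewrite -leNgt (le_trans b0)// ltW.
  - exact: integrable_cst1.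
  - by move=> n x; rewrite expr0n ler01.
  - exact: sqr_indic_le1.
have [b1|b1] := leP 1 b.
  apply: (@trig_dense_dominated (fun=> cst 1) _ (cst 1)) => //.
  - by move=> _; exact: trig_dense_cst.
  - apply: (@ae_circle _ b) => x /andP[x0 x1] xb.
    rewrite indicE mem_set; first exact: cvg_cst.
    by rewrite /= in_itv/= (lt_le_trans x1).
  - exact: integrable_cst1.
  - by move=> n x; rewrite expr1n.
  - exact: sqr_indic_le1.
by apply: trig_dense_ray01; rewrite b0.
Qed.

(** The sets whose indicator can be approximated form a Dynkin system, and the
half-lines are stable under intersection and generate the Borel sets. *)
Lemma trig_dense_indic (A : set (measurableTypeR R)) :
  measurable A -> trig_dense (complexify (\1_A : R -> R)).
Proof.
pose D := [set A : set (measurableTypeR R) |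
  measurable A /\ trig_dense (complexify (\1_A : R -> R))].
suff : measurable `<=` D by move=> + mA => /(_ A mA)[].
move=> B; rewrite [X in X B](_ : _ = <<s @RGenInftyO.G R >>);
  last exact: RGenInftyO.measurableE.
rewrite -setI_closed_g_dynkin_g_sigma_algebra; last first.
  move=> _ _ [x ->] [y ->]; exists (Num.min x y).
  by apply/seteqP; split => z /=; rewrite !in_itv/= lt_min => /andP.
apply: smallest_sub => {B}; last first.
  by move=> _ [x ->]; split; [exact: measurable_itv|exact: trig_dense_ray].
split.
- split; first exact: measurableT.
  by rewrite indicT; exact: trig_dense_cst.
- move=> B [mB dB]; split; first exact: measurableC.
  rewrite (_ : complexify _ = fun x => 1 + (-1) * complexify (\1_B) x).
    apply: trig_denseD; last exact: trig_denseZ.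
    by apply: is_trig_dense; exact: is_trig_cst.
  apply/funext => x; rewrite /complexify indicC indicE.
  by case: (_ \in _); rewrite /= mulN1r ?rmorph0 ?rmorph1 ?subrr ?subr0.
- move=> F tF DF; split; first by apply: bigcupT_measurable => n; case: (DF n).
  have part n x : ((\sum_(0 <= i < n) \1_(F i) x)%:E =
      \sum_(0 <= i < n) (\1_(F i) x)%:E :> \bar R)%E by rewrite sumEFin.
  have cvF x : (\sum_(0 <= i < n) \1_(F i) x : R) @[n --> \oo] -->
    (\1_(\bigcup_n F n) x : R).
    have /fine_cvgP[_] : (\sum_(0 <= i < n) \1_(F i) x)%:E @[n --> \oo] -->
        ((\1_(\bigcup_n F n) x)%:E : \bar R).
      rewrite indic_bigcup//; under eq_fun do rewrite part.
      by apply: is_cvg_nneseries => i _ _; rewrite lee_fin.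
    exact.
  have leF n x : (\sum_(0 <= i < n) \1_(F i) x : R) <= 1.
    apply: (@le_trans _ _ (\1_(\bigcup_n F n) x)); last by rewrite indicE;
      case: (_ \in _).
    by rewrite -lee_fin part indic_bigcup//; apply: nneseries_lim_ge => i _ _;
      rewrite lee_fin.
  apply: (@trig_dense_dominated
    (fun n x => \sum_(0 <= i < n) \1_(F i) x) _ (cst 1)).
  + move=> n; rewrite (_ : complexify _ =
      fun x => \sum_(i < n) complexify (\1_(F i)) x).
      by apply: trig_dense_sum => i; case: (DF i).
    by apply/funext => x; rewrite /complexify rmorph_sum big_mkord.
  + by apply: measurable_indic; apply: bigcupT_measurable => n; case: (DF n).
  + exact: nearW.
  + exact: integrable_cst1.
  + by move=> n x; rewrite expr_le1// sumr_ge0.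
  + by move=> x; exact: (sqr_indic_le1 (\bigcup_n F n) x).
Qed.

Import HBNNSimple.

(** A nonnegative function is the increasing limit of simple functions, which are
finite combinations of indicators. *)
Lemma trig_dense_nonneg (g : R -> R) : measurable_fun setT g ->
  (forall x, 0 <= g x) ->
  mu.-integrable setT (fun x => (g x ^+ 2)%:E) -> trig_dense (complexify g).
Proof.
move=> mg g0 ig.
have mEg : measurable_fun [set: measurableTypeR R] (EFin \o g).
  exact/measurable_EFinP.
pose g_ := nnsfun_approx measurableT mEg.
have cg x : g_ n x @[n --> \oo] --> g x.
  have h := @cvg_nnsfun_approx _ _ _ _ measurableT _ mEg.
  have /fine_cvgP[_] : EFin \o g_^~ x @ \oo --> (g x)%:E.
    by apply: h => // y _; rewrite lee_fin.
  exact.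
have leg n x : g_ n x <= g x.
  have nd := nd_nnsfun_approx measurableT mEg.
  have : nondecreasing_seq (fun n => g_ n x) by move=> i j ij; exact/lefP/nd.
  move=> /nondecreasing_cvgn_le /(_ _ n) /=; rewrite (cvg_lim _ (cg x))//;
    apply.
  exact: cg.
apply: (@trig_dense_dominated (fun n x => g_ n x) _ (fun x => g x ^+ 2)) => //.
- move=> n; pose S : seq R := finmap.enum_fset (fset_set (range (g_ n))).
  rewrite (_ : complexify _ = fun x => \sum_(i < size S)
      (S`_i)%:C%C * complexify (\1_(g_ n @^-1` [set S`_i])) x).
    apply: trig_dense_sum => i; apply: trig_denseZ; apply: trig_dense_indic.
    exact: measurable_funPTI.
  apply/funext => x; rewrite /complexify [in LHS]fimfunEord rmorph_sum;
    apply: eq_bigr => i _.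
  by rewrite rmorphM.
- exact: nearW.
- by move=> n x; rewrite ler_pXn2r// nnegrE.
Qed.

Lemma trig_dense_inL2 F : inL2 F -> trig_dense F.
Proof.
have real g : measurable_fun setT g ->
  mu.-integrable setT (fun x => (g x ^+ 2)%:E) ->
    trig_dense (complexify g).
  move=> mg ig.
  have part (s : R) : `|s| = 1 ->
    trig_dense (complexify (fun x => Num.max (s * g x) 0)).
    move=> s1; have mpos : measurable_fun setT (fun x => Num.max (s * g x) 0).
      by apply: measurable_maxr => //; exact: measurable_funM.
    apply: trig_dense_nonneg => //; first by move=> x; rewrite le_max lexx orbT.
    apply: le_integrable ig => //.
      by apply/measurable_EFinP; exact: measurable_funX.
    move=> x _ /=; rewrite lee_fin !normrX ler_pXn2r ?nnegrE//.
    rewrite -[leRHS]mul1r -s1 -normrM /Order.max; case: ifP => // _;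
      rewrite normr0//.
  rewrite (_ : complexify g =
    fun x => complexify (fun x => Num.max (1 * g x) 0) x +
    (-1) * complexify (fun x => Num.max (-1 * g x) 0) x).
    apply: trig_denseD; first by apply: part; rewrite normr1.
    by apply: trig_denseZ; apply: part; rewrite normrN1.
  apply/funext => x; rewrite /complexify mulN1r -rmorphB mul1r mulN1r;
    congr (_%:C%C).
  have [h|h] := leP 0 (g x).
    by rewrite max_r ?oppr_le0// subr0.
  by rewrite max_l ?oppr_ge0 ?(ltW h)// sub0r opprK.
move=> [[mr mi] iF].
rewrite (_ : F = fun x => complexify (fun x => complex.Re (F x)) x +
   'i%C * complexify (fun x => complex.Im (F x)) x); last first.
  by apply/funext => x; rewrite /complexify [LHS]complexE.
have dom (g : R -> R) : measurable_fun setT g ->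
    (forall x, g x ^+ 2 <= dot (F x) (F x)) ->
      mu.-integrable setT (fun x => (g x ^+ 2)%:E).
  move=> mg hg; apply: le_integrable iF => //.
    by apply/measurable_EFinP; exact: measurable_funX.
  by move=> x _ /=; rewrite lee_fin normrX real_normK ?num_real//
    (le_trans (hg x))// ler_norm.
apply: trig_denseD; last apply: trig_denseZ; apply: real => //;
  apply: dom => // x.
- by rewrite /dot -!expr2 lerDl sqr_ge0.
- by rewrite /dot -!expr2 lerDr sqr_ge0.
Qed.

End Density.

(** * Invariance of the circle under dilations *)

Section Dilation.
Context {R : realType}.
Local Notation mu := (@circle_measure R).
Local Notation leb := (@lebesgue_measure R).

Section Affine.
Variables (c d : R).
Hypothesis c0 : 0 < c.
Let phi : measurableTypeR R -> measurableTypeR R := fun x => c * x - d.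

Lemma preimage_affine b1 b2 (a b : R) :
  phi @^-1` [set` Interval (BSide b1 a) (BSide b2 b)] =
  [set` Interval (BSide b1 ((a + d) / c)) (BSide b2 ((b + d) / c))].
Proof.
apply/seteqP; split => x /=; rewrite /phi !in_itv/=; case: b1; case: b2;
  by rewrite /= ?(ler_pdivrMr _ _ c0, ltr_pdivrMr _ _ c0, ler_pdivlMr _ _ c0,
     ltr_pdivlMr _ _ c0, mulrC x) ?(lerBrDr, ltrBrDr, lerBlDr, ltrBlDr).
Qed.

Lemma measurable_affine : measurable_fun setT phi.
Proof. by apply: measurable_funB => //; apply: measurable_funM. Qed.

(** The image of Lebesgue measure under an increasing affine map, rescaled by the
slope, gives every interval its length, so it is Lebesgue measure. *)
Lemma ge0_integral_affine (D : set (measurableTypeR R)) (h : R -> \bar R) :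
  measurable D -> measurable_fun setT h -> (forall x, 0 <= h x)%E ->
  (\int[leb]_(y in D) h y =
    c%:E * \int[leb]_(x in phi @^-1` D) h (c * x - d)%R)%E.
Proof.
move=> mD mh h0.
have mphi := measurable_affine.
rewrite -[X in (_ * X)%E]/(\int[leb]_(x in phi @^-1` D) (h \o phi) x)%E.
rewrite -(ge0_integral_pushforward mphi leb)//; last exact: measurable_funTS.
rewrite -[c]/((NngNum (ltW c0))%:num) -ge0_integral_mscale//;
  last exact: measurable_funTS.
apply: eq_measure_integral => A mA _; apply: lebesgue_measure_unique => //=.
move=> _ [[a b]] _ <-; rewrite /mscale.
rewrite -[X in (_ = _ * X)%E]/(leb (phi @^-1` `]a, b]%classic)).
rewrite preimage_affine /=.
rewrite !lebesgue_measure_itv/= !lte_fin ltr_pM2r ?invr_gt0// ltrD2r.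
case: ifP => _; last by rewrite mule0.
by rewrite -!EFinD -EFinM; congr EFin; field; rewrite gt_eqF.
Qed.

End Affine.

(** The unit interval is cut into [k] pieces of length [1/k]; the map
[x |-> kx - r] sends the piece number [r] onto the whole interval and, by
periodicity, does not change [h(kx)]. *)
Lemma ge0_integral_dilate (k : nat) (h : R -> \bar R) : (0 < k)%N ->
  measurable_fun setT h -> (forall x, 0 <= h x)%E ->
  (forall x, h (x + 1) = h x) ->
  (\int[mu]_x h (k%:R * x)%R = \int[mu]_x h x)%E.
Proof.
move=> k0 mh h0 hper.
have kR : 0 < k%:R :> R by rewrite ltr0n.
have hperr (r : nat) x : h (x + r%:R) = h x.
  by elim: r => [|r ih]; rewrite ?addr0// -natr1 addrA hper.
have mhk : measurable_fun [set: measurableTypeR R] (fun x : R => h (k%:R * x)).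
  have mk : measurable_fun [set: measurableTypeR R]
    (fun x : R => k%:R * x : measurableTypeR R).
    exact: measurable_funM.
  exact: measurableT_comp mh mk.
rewrite !ge0_circle_integral//.
rewrite -![in LHS]integral_itv_bndo_bndc; try exact: measurable_funTS.
rewrite -![in RHS]integral_itv_bndo_bndc; try exact: measurable_funTS.
set I := (\int[leb]_(x in `[0%R, 1%R[) h x)%E.
have I0 : (0 <= I)%E by apply: integral_ge0.
have piece (r : nat) : (\int[leb]_(x in `[(r%:R / k%:R)%R,
  (r.+1%:R / k%:R)%R[) h (k%:R * x)%R
    = (k%:R^-1)%:E * I)%E.
  rewrite /I [X in (_ * X)%E](@ge0_integral_affine k%:R r%:R kR)//.
  rewrite (preimage_affine r%:R kR) add0r [1 + r%:R]addrC natr1.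
  rewrite muleA -EFinM mulVf ?gt_eqF// mul1e.
  apply: eq_integral => x _.
  rewrite -[in RHS](hperr r) subrK//.
have acc (r : nat) : (\int[leb]_(x in `[0%R, (r%:R / k%:R)%R[) h (k%:R * x)%R
    = (r%:R / k%:R)%:E * I)%E.
  elim: r => [|r ih]; first by rewrite mul0r set_itvco0 integral_set0 mul0e.
  have rk0 : 0 <= r%:R / k%:R :> R by rewrite divr_ge0.
  have rk1 : r%:R / k%:R <= r.+1%:R / k%:R :> R.
    by rewrite ler_pM2r ?invr_gt0// ler_nat.
  rewrite (_ : `[0, r.+1%:R / k%:R[ = `[0, r%:R / k%:R[ `|` `[r%:R / k%:R,
    r.+1%:R / k%:R[)%classic; last first.
    apply/seteqP; split => x /=; rewrite !in_itv/=.
      by move=> /andP[-> ->]; have [xr|xr] := ltP x (r%:R / k%:R); [left|right].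
    move=> [/andP[-> xr]|/andP[xr ->]]; first by rewrite (lt_le_trans xr).
    by rewrite (le_trans rk0).
  rewrite ge0_integral_setU//=; last 2 first.
  - exact: measurable_funTS.
  - rewrite disj_set2E; apply/eqP/seteqP; split => x //=; rewrite !in_itv/=.
    by move=> [/andP[_ xr] /andP[rx _]]; move: (lt_le_trans xr rx);
      rewrite ltxx.
  rewrite ih piece -ge0_muleDl ?lee_fin ?invr_ge0//.
  by rewrite -EFinD -[r.+1%:R]natr1 mulrDl mul1r.
by have := acc k; rewrite divff ?gt_eqF// mul1e.
Qed.

Lemma cmeasurable_dilate F k : cmeasurable F ->
  cmeasurable (dilate F k : R -> R[i]).
Proof.
move=> [mr mi].
have mk : measurable_fun [set: measurableTypeR R]
  (fun x : R => k%:R * x : measurableTypeR R).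
  exact: measurable_funM.
by split; [exact: measurableT_comp mr mk|exact: measurableT_comp mi mk].
Qed.

Lemma integral_dot_dilate F k : (0 < k)%N -> periodic F 1 -> cmeasurable F ->
  (\int[mu]_x (dot (dilate F k x) (dilate F k x))%:E =
    \int[mu]_x (dot (F x) (F x))%:E)%E.
Proof.
move=> k0 pF mF.
apply: (@ge0_integral_dilate k (fun x => (dot (F x) (F x))%:E)) => //.
- by apply/measurable_EFinP; exact: cmeasurable_dot.
- by move=> x; rewrite lee_fin dot_ge0.
- by move=> x; rewrite pF.
Qed.

Lemma inL2_dilate F k : (0 < k)%N -> periodic F 1 -> inL2 F ->
  inL2 (dilate F k : R -> R[i]).
Proof.
move=> k0 pF [mF iF]; have mFk := @cmeasurable_dilate F k mF; split => //.
apply/integrableP; split; first by apply/measurable_EFinP;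
  exact: cmeasurable_dot.
under eq_integral do rewrite gee0_abs ?lee_fin ?dot_ge0//.
rewrite integral_dot_dilate//; move/integrableP : iF => [_].
by under eq_integral do rewrite gee0_abs ?lee_fin ?dot_ge0//.
Qed.

Lemma sqnorm_dilate F k : (0 < k)%N -> periodic F 1 -> inL2 F ->
  sqnorm (dilate F k : R -> R[i]) = sqnorm F.
Proof.
move=> k0 pF [mF iF]; rewrite /sqnorm /ip /Rintegral; congr fine.
exact: integral_dot_dilate.
Qed.

End Dilation.

(** * Mean convergence of Fourier series *)

Section PartialSums.
Context {R : realType}.
Implicit Types (F : R -> R[i]) (a : int -> R[i]).

(** The integers of absolute value at most [J], with the nonnegative and the negative
ones listed separately so that a sum over them splits into two sums over naturals. *)
Definition frequencies (J : nat) : seq int :=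
  [seq Posz h | h <- iota 0 J.+1] ++ [seq Negz h | h <- iota 0 J].

Lemma mem_frequencies J j : (j \in frequencies J) = (`|j| <= J)%N.
Proof.
rewrite mem_cat; apply/orP/idP => [[/mapP[h + ->]|/mapP[h + ->]]|].
- by rewrite mem_iota.
- by rewrite mem_iota.
- by case: j => h hJ; [left|right]; apply/mapP; exists h => //;
    rewrite mem_iota.
Qed.

Lemma uniq_frequencies J : uniq (frequencies J).
Proof.
rewrite cat_uniq !map_inj_uniq ?iota_uniq ?andbT//=; [|by move=> ? ? []..].
by apply/hasPn => j /mapP[h _ ->]; apply/mapP => -[].
Qed.

Definition fourier_partial a (J : nat) : R -> R[i] :=
  trig [seq (j, a j) | j <- frequencies J].

Lemma big_pick (I : eqType) (r : seq I) (i : I) (x : R) (f : I -> R) : uniq r ->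
  \sum_(j <- r) (j == i)%:R * f j = (i \in r)%:R * f i.
Proof.
move=> ur; have [ir|ir] := boolP (i \in r).
  rewrite (bigD1_seq i)//= eqxx !mul1r big1 ?addr0// => j /negbTE ->.
  by rewrite mul0r.
rewrite mul0r big_seq big1// => j jr; rewrite (_ : (j == i) = false) ?mul0r//.
by apply/negbTE; apply: contraNneq ir => <-.
Qed.

Lemma ip_fourier_partial a J (p : int * R[i]) :
  ip (fourier_partial a J) (fun x => p.2 * character p.1 x) =
  (p.1 \in frequencies J)%:R * dot (a p.1) p.2.
Proof.
have -> : (fun x => p.2 * character p.1 x) = trig [:: p].
  by apply/funext => x; rewrite /trig big_seq1.
rewrite ip_trig big_map.
under eq_bigr do rewrite big_seq1 /=.
exact: (@big_pick _ _ p.1 0 (fun j => dot (a j) p.2)) (uniq_frequencies J).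
Qed.

(** The difference of [F] and its partial sum is orthogonal to all characters of
frequency at most [J], hence to the difference of the two polynomials; this is
the theorem of Pythagoras. *)
Lemma fourier_partial_best F a J (s : seq (int * R[i])) : inL2 F ->
  fourier_series F a ->
  (forall p, p \in s -> (`|p.1| <= J)%N) ->
  sqnorm (fun x => F x - fourier_partial a J x) <=
    sqnorm (fun x => F x - trig s x).
Proof.
move=> F2 aF sJ.
have P2 := inL2_trig [seq (j, a j) | j <- frequencies J];
  rewrite -/(fourier_partial a J) in P2.
have D2 := inL2B F2 P2.
(* The difference of the two polynomials; its frequencies are at most J. *)
pose u := s ++ [seq (p.1, - p.2) | p <- [seq (j, a j) | j <- frequencies J]].
have uJ p : p \in u -> p.1 \in frequencies J.
  rewrite mem_cat => /orP[ps|]; first by rewrite mem_frequencies sJ.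
  by rewrite -map_comp => /mapP[j jJ ->].
have U0 : ip (fun x => F x - fourier_partial a J x) (trig u) = 0.
  rewrite ip_trigr// big_seq big1// => p /uJ pJ.
  rewrite ipBl//; last exact: inL2_character.
  by rewrite ip_fourier_partial pJ mul1r ip_fourier_coef// -aF dotC subrr.
have -> : (fun x => F x - trig s x) =
    (fun x => (F x - fourier_partial a J x) - trig u x).
  apply/funext => x; rewrite /u trig_cat trig_opp -/(fourier_partial a J x).
  by ring.
rewrite [leRHS]sqnormB//; last exact: inL2_trig.
by rewrite U0 mulr0 subr0 lerDl ip_ge0.
Qed.

Lemma cvg_fourier_partial F a : inL2 F -> fourier_series F a ->
  sqnorm (fun x => F x - fourier_partial a J x) @[J --> \oo] --> (0 : R).
Proof.
move=> F2 aF; apply/cvgrPdist_le => eps eps0.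
have [_ /(_ _ eps0)[s Fs]] := trig_dense_inL2 F2.
exists (\max_(p <- s) `|p.1|%N) => // J /= sJ.
rewrite sub0r normrN ger0_norm ?ip_ge0//.
apply: le_trans (fourier_partial_best F2 aF _) Fs => p ps.
by apply: leq_trans sJ; exact: leq_bigmax_seq.
Qed.

(** Convergence in mean implies convergence of the norms; the cross term is
controlled by the Cauchy-Schwarz inequality. *)
Lemma cvg_sqnorm (G_ : nat -> R -> R[i]) F : inL2 F ->
  (forall n, inL2 (G_ n)) ->
  sqnorm (fun x => F x - G_ n x) @[n --> \oo] --> (0 : R) ->
  sqnorm (G_ n) @[n --> \oo] --> sqnorm F.
Proof.
move=> F2 G2 cG.
have E n : sqnorm (G_ n) =
  sqnorm F - 2 * ip F (fun x => F x - G_ n x) + sqnorm (fun x => F x - G_ n x).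
  rewrite -sqnormB//; last exact: inL2B.
  by congr sqnorm; apply/funext => x; rewrite opprB addrC subrK.
have cS : Num.sqrt (sqnorm F * sqnorm (fun x => F x - G_ n x))
    @[n --> \oo] --> (0 : R).
  have h : sqnorm F * sqnorm (fun x => F x - G_ n x)
      @[n --> \oo] --> sqnorm F * 0.
    by apply: cvgM => //; exact: cvg_cst.
  have := continuous_cvg _ (@sqrt_continuous R (sqnorm F * 0)) h.
  rewrite mulr0 sqrtr0; exact.
have cip : ip F (fun x => F x - G_ n x) @[n --> \oo] --> (0 : R).
  apply/norm_cvg0P; apply: squeeze_cvgr (cvg_cst 0) cS.
  near=> n; rewrite normr_ge0 /= -sqrtr_sqr ler_wsqrtr//.
  by apply: cauchy_schwarz => //; exact: inL2B.
under eq_fun do rewrite E.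
have : sqnorm F - 2 * ip F (fun x => F x - G_ n x)
    + sqnorm (fun x => F x - G_ n x) @[n --> \oo] --> sqnorm F - 2 * 0 + 0.
  apply: cvgD => //; apply: cvgB; first exact: cvg_cst.
  by apply: cvgM => //; exact: cvg_cst.
by rewrite mulr0 subr0 addr0.
Unshelve. all: by end_near.
Qed.

End PartialSums.

(** * The Gram matrix of the dilates *)

Section Gram.
Context {R : realType}.
Implicit Types (a : int -> R[i]).

(** The inner product of the dilates of order [k] and [l] of a partial sum: the
characters of frequency [jk] and [il] contribute only when they coincide. *)
Definition gram a (J k l : nat) : R :=
  \sum_(j <- frequencies J) \sum_(i <- frequencies J)
    (j * k%:Z == i * l%:Z)%:R * dot (a j) (a i).

Lemma sqnorm_fourier_combination a J (K : seq nat) (c : nat -> R) :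
  sqnorm (fun x => \sum_(k <- K) (c k)%:C%C * fourier_partial a J (k%:R * x)) =
  \sum_(k <- K) \sum_(l <- K) c k * c l * gram a J k l.
Proof.
pose s := [seq (j * k%:Z, (c k)%:C%C * a j) | k <- K, j <- frequencies J].
rewrite (_ : (fun x => _) = trig s); last first.
  apply/funext => x; rewrite /trig big_allpairs_dep; apply: eq_bigr => k _.
  rewrite /fourier_partial trig_dilate /trig !big_map mulr_sumr.
  by apply: eq_bigr => j _; rewrite mulrA.
rewrite /sqnorm ip_trig big_allpairs_dep; apply: eq_bigr => k _.
under eq_bigr do rewrite big_allpairs_dep.
rewrite exchange_big; apply: eq_bigr => l _ /=.
rewrite /gram mulr_sumr; apply: eq_bigr => j _; rewrite mulr_sumr;
  apply: eq_bigr => i _.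
by rewrite dotZl dotC dotZl dotC; ring.
Qed.

(** A solution [i] of [jk = il] is determined by [j], and [jk = il] forces
[l / gcd(k,l)], which is prime to [k / gcd(k,l)], to divide [j]. *)
Lemma count_solutions (J k l : nat) (j : int) : (0 < k)%N -> (0 < l)%N ->
  \sum_(i <- frequencies J) (j * k%:Z == i * l%:Z)%:R <=
    (l %/ gcdn k l %| `|j|)%N%:R :> R.
Proof.
move=> k0 l0.
have [[i /andP[iJ /eqP ji]]|nex] := pselect
    (exists i, (i \in frequencies J) && (j * k%:Z == i * l%:Z)).
  have -> : (l %/ gcdn k l %| `|j|)%N.
    have d0 : (0 < gcdn k l)%N by rewrite gcdn_gt0 k0.
    have cop : coprime (l %/ gcdn k l) (k %/ gcdn k l).
      by rewrite /coprime -(eqn_pmul2r d0) muln_gcdl !divnK ?dvdn_gcdl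
        ?dvdn_gcdr// gcdnC mul1n.
    rewrite -(Gauss_dvdl _ cop) -(@dvdn_pmul2r (gcdn k l))//.
    rewrite -mulnA !divnK ?dvdn_gcdl ?dvdn_gcdr//.
    have := congr1 absz ji; rewrite !abszM !absz_nat => ->; exact: dvdn_mull.
  rewrite (bigD1_seq i) ?uniq_frequencies//= ji eqxx big1 ?addr0// => i' ii'.
  rewrite (_ : (i * l%:Z == i' * l%:Z) = false)//; apply/negbTE;
    apply: contra ii' => /eqP h.
  by apply/eqP; apply: (mulIf _ (esym h)); rewrite -lt0n in l0 *; case: (l) l0.
rewrite big_seq big1//= => i iJ; case: eqP => // ji; exfalso; apply: nex.
by exists i; rewrite iJ; apply/eqP.
Qed.

Definition multiple_energy a (J q : nat) : R :=
  \sum_(j <- frequencies J) (q %| `|j|)%N%:R * dot (a j) (a j).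

(** Each product is at most the half sum of the squares; then the solutions of
[jk = il] are counted once for given [j] and once for given [i]. *)
Lemma gram_le a (J k l : nat) : (0 < k)%N -> (0 < l)%N ->
  `|gram a J k l| <= (multiple_energy a J (l %/ gcdn k l)
     + multiple_energy a J (k %/ gcdn k l)) / 2.
Proof.
move=> k0 l0.
apply: (@le_trans _ _ (\sum_(j <- frequencies J) \sum_(i <- frequencies J)
    (j * k%:Z == i * l%:Z)%:R * ((dot (a j) (a j) + dot (a i) (a i)) / 2))).
  apply: le_trans (ler_norm_sum _ _ _) _; apply: ler_sum => j _.
  apply: le_trans (ler_norm_sum _ _ _) _; apply: ler_sum => i _.
  by rewrite normrM ger0_norm// ler_wpM2l// dot_le.
under eq_bigr do under eq_bigr do rewrite mulrA mulrDr mulrDl.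
under eq_bigr do rewrite big_split /=.
rewrite big_split /= mulrDl; apply: lerD.
  rewrite /multiple_energy mulr_suml; apply: ler_sum => j _.
  rewrite -mulr_suml -mulr_suml !ler_wpM2r ?invr_ge0// ?dot_ge0//.
  exact: count_solutions.
rewrite exchange_big /multiple_energy mulr_suml; apply: ler_sum => i _ /=.
rewrite -mulr_suml -mulr_suml !ler_wpM2r ?invr_ge0// ?dot_ge0//.
rewrite gcdnC; under eq_bigr do rewrite eq_sym.
exact: count_solutions.
Qed.

End Gram.

(** * Consequences of the growth condition on the coefficients *)

Section Windows.
Context {R : realType}.

Lemma exists_power (M x : R) : 1 < M -> exists n, x < M ^+ n.
Proof.
move=> M1; exists (Num.truncn (`|x| / (M - 1))).+1.
have M10 : 0 < M - 1 by rewrite subr_gt0.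
have h := bernoulli_inequality (Num.truncn (`|x| / (M - 1))).+1
  (_ : -1 <= M - 1).
rewrite [1 + (M - 1)]addrC subrK in h; apply: lt_le_trans (h _); last by lra.
rewrite (le_lt_trans (ler_norm x))// -[ltLHS]add0r ltrD//.
by rewrite -ltr_pdivrMr// truncnS_gt.
Qed.

Lemma exists_window (M : R) (h : nat) : 1 < M -> (0 < h)%N ->
  exists v, M ^+ v <= h%:R < M ^+ v.+1.
Proof.
move=> M1 h0.
have ex : exists n, h%:R < M ^+ n by exact: exists_power.
case: (ex_minnP ex) => -[|v] hv minv; first by rewrite expr0 ltrn1 in hv;
  case: (h) h0 hv.
exists v; rewrite hv andbT leNgt; apply/negP => /minv; by rewrite ltnn.
Qed.

Lemma count_multiples (q J : nat) (X : R) : (0 < q)%N -> 0 <= X ->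
  (\sum_(1 <= h < J.+1) ((q %| h)%N && (h%:R < X)%R : nat))%N%:R <= X / q%:R.
Proof.
move=> q0 X0; have qR : 0 < q%:R :> R by rewrite ltr0n.
pose H := Num.truncn X.
have HX : H%:R <= X by rewrite truncn_le.
apply: (@le_trans _ _ (H %/ q)%N%:R); last first.
  by rewrite ler_pdivlMr// -natrM (le_trans _ HX)// ler_nat leq_divM.
rewrite ler_nat divn_count_dvd.
apply: (@leq_trans (\sum_(1 <= h < (J + H).+1) ((q %| h) && (h <= H)%N)))%N.
  rewrite [leqRHS](@big_cat_nat _ _ _ J.+1)//= ?ltnS ?leq_addr//.
  apply: leq_trans (leq_addr _ _); apply: leq_sum => h _.
  case: (q %| h)%N => //=; case: ltP => // hX.
  suff -> : (h <= H)%N by [].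
  by rewrite -ltnS -(ltr_nat R) (lt_trans hX)// truncnS_gt.
rewrite (@big_cat_nat _ _ _ H.+1)//= ?ltnS ?leq_addl//.
rewrite [X in (_ + X)%N]big_nat_cond [X in (_ + X)%N]big1 ?addn0; last first.
  by move=> h; rewrite andbT => /andP[Hh _]; rewrite leqNgt Hh andbF.
by apply: leq_sum => h _; case: (q %| h)%N => //=; exact: leq_b1.
Qed.

Section WindowBound.
Variables (a : int -> R[i]) (M : R).
Hypotheses (ha0 : a 0 = 0) (hM : 1 < M) (hL : (window_series a M < +oo)%E).

Let M0 : 0 < M. Proof. exact: lt_trans hM. Qed.

Lemma window_sup_ge0 v : (0 <= window_sup a M v)%E.
Proof. by apply: ereal_sup_ubound; left. Qed.

Lemma window_term_ge0 v : (0 <= (M ^+ v)%:E * window_sup a M v)%E.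
Proof. by rewrite mule_ge0 ?window_sup_ge0// lee_fin exprn_ge0// ltW. Qed.

Lemma window_partial V :
  (\sum_(0 <= v < V) (M ^+ v)%:E * window_sup a M v <= window_series a M)%E.
Proof. by apply: nneseries_lim_ge => v _ _; exact: window_term_ge0. Qed.

Lemma window_series_ge0 : (0 <= window_series a M)%E.
Proof. by apply: nneseries_ge0 => v _ _; exact: window_term_ge0. Qed.

Definition energy : R := fine (window_series a M).

Lemma energy_ge0 : 0 <= energy.
Proof. by rewrite fine_ge0// window_series_ge0. Qed.

(** A single term of the convergent series is finite, and so is the supremum since
its weight [M^v] is not zero. *)
Lemma window_sup_fin v : window_sup a M v \is a fin_num.
Proof.
rewrite ge0_fin_numE ?window_sup_ge0//.
have Mv : 0 < M ^+ v by rewrite exprn_gt0.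
have h : ((M ^+ v)%:E * window_sup a M v <= window_series a M)%E.
  apply: le_trans (window_partial v.+1); rewrite big_nat_recr//= leeDr//.
  by apply: sume_ge0 => w _; exact: window_term_ge0.
rewrite ltey; apply/eqP => E; have := le_lt_trans h hL.
by rewrite E gt0_muley ?lte_fin// ltxx.
Qed.

Let w v := fine (window_sup a M v).

Lemma w_ge0 v : 0 <= w v.
Proof. by rewrite fine_ge0// window_sup_ge0. Qed.

Lemma dot_window v j : M ^+ v <= `|j|%N%:R < M ^+ v.+1 ->
  dot (a j) (a j) <= w v.
Proof.
move=> hj; rewrite -lee_fin /w fineK ?window_sup_fin// -cmodulus2.
apply: ereal_sup_ubound; right; by exists j.
Qed.

(** Each nonzero [j] lies in one annulus [M^v <= |j| < M^(v+1)], where [|a_j|^2] is at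
most the supremum; the annulus contains at most [M^(v+1)/q] positive and as many
negative multiples of [q], and [M^(v+1)] is [M] times the weight of the series. *)
Lemma multiple_energy_le J q : (0 < q)%N ->
  multiple_energy a J q <= 2 * M * energy / q%:R.
Proof.
move=> q0; have qR : 0 < q%:R :> R by rewrite ltr0n.
(* The annuli of order at least V contain no frequency of size at most J. *)
have [V JV] := exists_power J.+1%:R hM.
pose u (h : nat) :=
  \sum_(0 <= v < V) ((M ^+ v <= h%:R) && (h%:R < M ^+ v.+1))%:R * w v.
have u0 h : 0 <= u h by apply: sumr_ge0 => v _; rewrite mulr_ge0 ?w_ge0.
have dotu j : (`|j| <= J)%N -> j != 0 -> dot (a j) (a j) <= u `|j|%N.
  move=> jJ j0.
  have [v hv] : exists v, M ^+ v <= `|j|%N%:R < M ^+ v.+1.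
    by apply: exists_window => //; rewrite absz_gt0.
  have vV : (v < V)%N.
    case/andP: hv => hv _; rewrite ltnNge; apply/negP => Vv.
    have := le_lt_trans hv (lt_trans (_ : _ < J.+1%:R) JV);
      rewrite ltr_nat ltnS jJ.
    by move=> /(_ isT); rewrite ltNge ler_weXn2l// ltW.
  apply: le_trans (dot_window hv) _.
  rewrite /u (bigD1_seq v) ?iota_uniq ?mem_index_iota//= hv mul1r lerDl.
  by apply: sumr_ge0 => v' _; rewrite mulr_ge0 ?w_ge0.
pose T := \sum_(1 <= h < J.+1) (q %| h)%N%:R * u h.
have mT : multiple_energy a J q <= T + T.
  rewrite /multiple_energy big_cat !big_map /= big_cons [a _]ha0 dot0l mulr0
    add0r lerD//.
    rewrite /T /index_iota subSS subn0 big_seq [leRHS]big_seq.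
    apply: ler_sum => h; rewrite mem_iota => /andP[h0 hJ].
    by rewrite ler_wpM2l// (dotu (Posz h))//; case: (h) h0.
  rewrite /T big_add1 /= /index_iota subn0 big_seq [leRHS]big_seq.
  apply: ler_sum => h; rewrite mem_iota => /andP[h0 hJ].
  by rewrite ler_wpM2l// (dotu (Negz h)).
apply: le_trans mT _.
suff TE : T <= M * energy / q%:R.
  by rewrite (_ : 2 * M * energy / q%:R =
    M * energy / q%:R + M * energy / q%:R) ?lerD//; ring.
have -> : T = \sum_(0 <= v < V) w v *
    (\sum_(1 <= h < J.+1)
      ((q %| h)%N && (M ^+ v <= h%:R < M ^+ v.+1)%R : nat))%N%:R.
  rewrite /T; under eq_bigr do rewrite /u mulr_sumr.
  rewrite exchange_big; apply: eq_bigr => v _ /=.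
  rewrite natr_sum mulr_sumr; apply: eq_bigr => h _.
  by rewrite mulrA -natrM mulnb mulrC.
apply: (@le_trans _ _ (\sum_(0 <= v < V) w v * (M ^+ v.+1 / q%:R))).
  apply: ler_sum => v _; apply: ler_wpM2l; first exact: w_ge0.
  apply: le_trans (count_multiples J q0 (exprn_ge0 _ (ltW M0))).
  rewrite ler_nat; apply: leq_sum => h _.
  by case: (q %| h)%N => //=; case: (_ <= _).
have -> : \sum_(0 <= v < V) w v * (M ^+ v.+1 / q%:R) =
    M / q%:R * \sum_(0 <= v < V) M ^+ v * w v.
  by rewrite mulr_sumr; apply: eq_bigr => v _; rewrite exprS; ring.
rewrite (_ : M * energy / q%:R = M / q%:R * energy); last by ring.
apply: ler_wpM2l.
  by rewrite divr_ge0// ltW.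
rewrite -lee_fin /energy fineK; last first.
  by rewrite ge0_fin_numE// window_series_ge0.
apply: le_trans (window_partial V); rewrite -sumEFin le_eqVlt; apply/orP; left;
  apply/eqP.
by apply: eq_bigr => v _; rewrite EFinM /w fineK// window_sup_fin.
Qed.

(** Of [1/k] and [1/l] the smaller one is [1/max(k,l)], and the larger one is at most
[mu] times that. *)
Lemma gram_le_gcd J (mu : R) (k l : nat) : (0 < k)%N -> (0 < l)%N ->
  k%:R <= mu * l%:R -> l%:R <= mu * k%:R ->
  `|gram a J k l| <= M * energy * (1 + mu) * ((gcdn k l)%:R / (maxn k l)%:R).
Proof.
move=> k0 l0 kl lk.
have d0 : (0 < gcdn k l)%N by rewrite gcdn_gt0 k0.
have kR : 0 < k%:R :> R by rewrite ltr0n.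
have lR : 0 < l%:R :> R by rewrite ltr0n.
have dR : 0 < (gcdn k l)%:R :> R by rewrite ltr0n.
have ME : 0 <= M * energy by rewrite mulr_ge0 ?energy_ge0// ltW.
apply: le_trans (gram_le a J k0 l0) _.
have lq : (0 < l %/ gcdn k l)%N by rewrite divn_gt0// dvdn_leq// dvdn_gcdr.
have kq : (0 < k %/ gcdn k l)%N by rewrite divn_gt0// dvdn_leq// dvdn_gcdl.
apply: (@le_trans _ _ (M * energy * (gcdn k l)%:R * (l%:R^-1 + k%:R^-1))).
  rewrite ler_pdivrMr//; apply: le_trans (lerD (multiple_energy_le J lq)
    (multiple_energy_le J kq)) _.
  rewrite !natf_div ?dvdn_gcdl ?dvdn_gcdr// le_eqVlt; apply/orP; left;
    apply/eqP.
  by field; rewrite ?gt_eqF.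
apply: (@le_trans _ _ (M * energy * (gcdn k l)%:R *
  ((1 + mu) / (maxn k l)%:R))); last first.
  by rewrite le_eqVlt; apply/orP; left; apply/eqP; ring.
apply: ler_wpM2l; first by rewrite mulr_ge0// ltW.
rewrite /maxn; case: ltnP => [_|_].
  rewrite mulrDl mul1r lerD2l ler_pdivlMr// mulrC ler_pdivrMr//.
rewrite mulrDl mul1r addrC lerD2l ler_pdivlMr// mulrC ler_pdivrMr//.
Qed.

End WindowBound.
End Windows.

(** * Linear combinations of the dilates *)

Section Combinations.
Context {R : realType}.
Implicit Types (F : R -> R[i]) (a : int -> R[i]) (c : nat -> R) (K : seq nat).

(** The Schur test: [2 |c_k c_l| <= c_k^2 + c_l^2] and the symmetry of the bound
reduce the form to its row sums. *)
Lemma quadratic_form_le K c (g B : nat -> nat -> R) (C : R) :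
  (forall k l, k \in K -> l \in K -> `|g k l| <= B k l) ->
  (forall k l, B k l = B l k) ->
  (forall k, k \in K -> \sum_(l <- K) B k l <= C) ->
  \sum_(k <- K) \sum_(l <- K) c k * c l * g k l <= C * \sum_(k <- K) c k ^+ 2.
Proof.
move=> gB Bsym BC.
apply: (@le_trans _ _ (\sum_(k <- K) \sum_(l <- K)
  (c k ^+ 2 / 2 * B k l + c l ^+ 2 / 2 * B l k))).
  rewrite big_seq [leRHS]big_seq; apply: ler_sum => k kK.
  rewrite big_seq [leRHS]big_seq; apply: ler_sum => l lK.
  rewrite (Bsym l k) -mulrDl -mulrDl.
  apply: le_trans (ler_norm _) _; rewrite normrM.
  apply: ler_pM => //; last exact: gB.
  have := sqr_ge0 (c k - c l); have := sqr_ge0 (c k + c l).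
  by rewrite ler_norml => h1 h2; apply/andP; split; nra.
under eq_bigr do rewrite big_split /=.
rewrite big_split /= [X in _ + X <= _]exchange_big /=.
rewrite -big_split /= mulr_sumr big_seq [leRHS]big_seq; apply: ler_sum => k kK.
rewrite -!mulr_sumr -mulrDl -splitr mulrC.
by apply: ler_wpM2r; [exact: sqr_ge0|exact: BC].
Qed.

Definition combination F K c : R -> R[i] :=
  fun x => \sum_(k <- K) (c k)%:C%C * dilate F k x.

Lemma periodic_character n : periodic (character n : R -> R[i]) 1.
Proof.
move=> x; rewrite /character mulrDr mulr1 cosD sinD.
by have [-> ->] := @sin_cos_2pin R n; rewrite !mulr0 !mulr1 subr0 addr0.
Qed.

Lemma periodic_trig (s : seq (int * R[i])) : periodic (trig s) 1.
Proof. by move=> x; apply: eq_bigr => p _; rewrite periodic_character. Qed.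

Lemma inL2_combination F K c : periodic F 1 -> inL2 F -> all (leq 1) K ->
  inL2 (combination F K c).
Proof.
move=> pF F2; elim: K => [_|k K ih /= /andP[k0 K0]].
  by rewrite (_ : combination _ _ _ = fun=> 0);
    [exact: inL2_0|apply/funext => x; rewrite /combination big_nil].
rewrite (_ : combination _ _ _ =
  fun x => (c k)%:C%C * dilate F k x + combination F K c x).
  by apply: inL2D; [apply: inL2Z; exact: inL2_dilate|exact: ih].
by apply/funext => x; rewrite /combination big_cons.
Qed.

Lemma cvg_combination F (G_ : nat -> R -> R[i]) K c :
  periodic F 1 -> inL2 F ->
  (forall n, periodic (G_ n) 1) -> (forall n, inL2 (G_ n)) ->
  all (leq 1) K ->
  sqnorm (fun x => F x - G_ n x) @[n --> \oo] --> (0 : R) ->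
  sqnorm (fun x => combination F K c x - combination (G_ n) K c x)
    @[n --> \oo] --> (0 : R).
Proof.
move=> pF F2 pG G2 + cG; elim: K => [_|k K ih /= /andP[k0 K0]].
  under eq_fun do under [X in sqnorm X]eq_fun do rewrite /combination !big_nil
    subrr.
  by rewrite /sqnorm ip0l; exact: cvg_cst.
have FK := @inL2_combination F K c pF F2 K0.
have GK n := @inL2_combination (G_ n) K c (pG n) (G2 n) K0.
have Fk : inL2 (dilate F k : R -> R[i]) by exact: inL2_dilate.
have Gk n : inL2 (dilate (G_ n) k : R -> R[i]) by exact: inL2_dilate.
have {}ih := ih K0.
have up : 2 * (c k ^+ 2 * sqnorm (fun x => F x - G_ n x)) +
    2 * sqnorm (fun x => combination F K c x - combination (G_ n) K c x)
    @[n --> \oo] --> (0 : R).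
  rewrite -[X in _ --> X](_ : 2 * (c k ^+ 2 * 0) + 2 * 0 = 0 :> R);
    last by ring.
  apply: cvgD; apply: cvgM; (try exact: cvg_cst) => //.
  by apply: cvgM => //; exact: cvg_cst.
apply: squeeze_cvgr (cvg_cst 0) up; near=> n; rewrite ip_ge0 /=.
have -> : (fun x => combination F (k :: K) c x -
      combination (G_ n) (k :: K) c x) =
    fun x => (c k)%:C%C * (dilate F k x - dilate (G_ n) k x) +
      (combination F K c x - combination (G_ n) K c x).
  by apply/funext => x; rewrite /combination !big_cons; ring.
have D2 : inL2 (fun x => dilate F k x - dilate (G_ n) k x) by exact: inL2B.
apply: le_trans (sqnormD_le _ _) _; [exact: inL2Z|exact: inL2B|].
rewrite lerD2r sqnormZ// ler_wpM2l// {1}/dot /= mulr0 addr0 -expr2.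
rewrite le_eqVlt; apply/orP; left; apply/eqP; congr (_ * _).
rewrite -(@sqnorm_dilate _ (fun x => F x - G_ n x) k)//; last exact: inL2B.
by move=> x; rewrite pF pG.
Unshelve. all: by end_near.
Qed.

Section FourierData.
Variables (f : R -> R[i]) (a : int -> R[i]).
Hypotheses (pf : periodic f 1) (f2 : inL2 f) (fa : fourier_series f a).

Lemma cvg_sqnorm_combination K c : all (leq 1) K ->
  sqnorm (combination (fourier_partial a J) K c) @[J --> \oo] -->
    sqnorm (combination f K c).
Proof.
move=> K0; have P2 J : inL2 (fourier_partial a J) by exact: inL2_trig.
have pP J : periodic (fourier_partial a J) 1 by exact: periodic_trig.
apply: cvg_sqnorm; first exact: inL2_combination.
  by move=> n; exact: inL2_combination.
by apply: cvg_combination => //; exact: cvg_fourier_partial.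
Qed.

(** The bound is uniform in the length [J] of the partial sums, so it survives the
passage to the limit. *)
Lemma sqnorm_combination_le K c (g : nat -> nat -> R) (C : R) : all (leq 1) K ->
  (forall k l, k \in K -> l \in K -> forall J, `|gram a J k l| <= g k l) ->
  (forall k l, g k l = g l k) ->
  (forall k, k \in K -> \sum_(l <- K) g k l <= C) ->
  sqnorm (combination f K c) <= C * \sum_(k <- K) c k ^+ 2.
Proof.
move=> K0 hg gsym gC; apply: (@cvgr_to_le _ _ _ _ _ _ _
  (@cvg_sqnorm_combination K c K0)).
apply: nearW => J; rewrite [leLHS]sqnorm_fourier_combination.
by apply: quadratic_form_le gsym gC => k l kK lK; exact: hg.
Qed.

(** All terms of the quadratic form are nonnegative, and the diagonal entries of the
Gram matrix are the squared norms of the partial sums. *)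
Lemma sqnorm_combination_ge K c : all (leq 1) K -> uniq K ->
  constant_sign a -> constant_sign c ->
  sqnorm f * \sum_(k <- K) c k ^+ 2 <= sqnorm (combination f K c).
Proof.
move=> K0 uK sa sc.
have ca k l : 0 <= c k * c l.
  by case: sc => sc; [rewrite mulr_ge0|rewrite mulr_le0].
have da i j : 0 <= dot (a i) (a j).
  have h z w : 0 <= z :> R[i] -> 0 <= w -> 0 <= dot z w.
    rewrite !lecE /= => /andP[/eqP z0 z1] /andP[/eqP w0 w1].
    by rewrite /dot z0 mul0r addr0 mulr_ge0.
  have h' z w : z <= 0 :> R[i] -> w <= 0 -> 0 <= dot z w.
    rewrite !lecE /= => /andP[/eqP z0 z1] /andP[/eqP w0 w1].
    by rewrite /dot -z0 mul0r addr0 mulr_le0.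
  by case: sa => sa; [exact: h|exact: h'].
have P2 J : inL2 (fourier_partial a J) by exact: inL2_trig.
have cP : sqnorm (fourier_partial a J) @[J --> \oo] --> sqnorm f.
  by apply: cvg_sqnorm => //; exact: cvg_fourier_partial.
have cPc : sqnorm (fourier_partial a J) * \sum_(k <- K) c k ^+ 2
    @[J --> \oo] --> sqnorm f * \sum_(k <- K) c k ^+ 2.
  by apply: cvgM => //; exact: cvg_cst.
have le_lim := ler_cvg_to cPc (@cvg_sqnorm_combination K c K0).
apply: le_lim.
apply: nearW => J; rewrite [leRHS]sqnorm_fourier_combination mulr_sumr.
rewrite big_seq [leRHS]big_seq; apply: ler_sum => k kK.
have gram_ge0 l : 0 <= gram a J k l.
  by apply: sumr_ge0 => j _; apply: sumr_ge0 => i _; rewrite mulr_ge0.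
rewrite (bigD1_seq k)//= -expr2 mulrC; apply: ler_wpDr.
  by apply: sumr_ge0 => l _; rewrite mulr_ge0.
rewrite ler_wpM2l ?sqr_ge0// /sqnorm ip_trig big_map /gram;
  apply: ler_sum => j _.
rewrite big_map; apply: ler_sum => i _ /=; rewrite ler_wpM2r// ler_nat.
by case: eqP => // ->; rewrite eqxx.
Qed.

End FourierData.
End Combinations.

(** * Increments over geometric intervals *)

Section Assembly.
Context {R : realType}.
Implicit Types (f : R -> R[i]) (a : int -> R[i]) (c : nat -> R).
Implicit Types (N : set nat) (mu : R).

(** The indices that occur in the increment number [j].  The interval is open on
the left and closed on the right, contrary to that of a block. *)
Definition incr_range N mu (j : nat) : seq nat :=
  [seq k <- iota 0 (Num.truncn (mu ^+ j.+1)).+1 |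
    (k \in N) && (mu ^+ j < k%:R <= mu ^+ j.+1)].

Lemma lt_bound (t : R) (B k : nat) : t < B%:R -> k%:R <= t -> (k < B)%N.
Proof. by move=> tB kt; rewrite -(ltr_nat R) (le_lt_trans kt). Qed.

Lemma mem_incr_range N mu j k :
  (k \in incr_range N mu j) = (k \in N) && (mu ^+ j < k%:R <= mu ^+ j.+1).
Proof.
rewrite mem_filter mem_iota add0n; apply: andb_idr => /and3P[_ _ kt].
exact: lt_bound (truncnS_gt _) kt.
Qed.

Lemma uniq_incr_range N mu j : uniq (incr_range N mu j).
Proof. by rewrite filter_uniq// iota_uniq. Qed.

(** Enumerations with different upper bounds agree, which allows the ranges of
several increments to be compared inside one list. *)
Lemma big_incr_range N mu j (B : nat) (V : nmodType) (g : nat -> V) :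
  mu ^+ j.+1 < B%:R ->
  \sum_(k <- incr_range N mu j) g k =
  \sum_(k <- iota 0 B | (k \in N) && (mu ^+ j < k%:R <= mu ^+ j.+1)) g k.
Proof.
move=> tB; rewrite -[RHS]big_filter; apply: perm_big; apply: uniq_perm.
- exact: uniq_incr_range.
- by rewrite filter_uniq// iota_uniq.
- move=> k; rewrite mem_incr_range mem_filter mem_iota add0n /=.
  by apply/esym/andb_idr => /and3P[_ _ kt]; exact: lt_bound tB kt.
Qed.

Lemma dilated_sumE f N c (t : R) (B : nat) x : t < B%:R ->
  dilated_sum f N c t x =
  \sum_(k <- iota 0 B | (k \in N) && (k%:R <= t)) (c k)%:C%C * dilate f k x.
Proof.
move=> tB; rewrite -[RHS]big_filter fsbig_seq ?filter_uniq ?iota_uniq//.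
rewrite /dilated_sum; set s := [seq _ <- _ | _].
suff -> : N `&` [set k : nat | k%:R <= t] = [set` s] by [].
apply/seteqP; split => k /=.
  move=> [Nk kt]; rewrite mem_filter mem_set//= kt mem_iota add0n/=.
  exact: lt_bound tB kt.
by rewrite mem_filter => /andP[/andP[Nk kt] _]; split => //; exact: set_mem.
Qed.

Lemma incrementE f N c mu j : 1 < mu ->
  increment f N c mu j = combination f (incr_range N mu j) c.
Proof.
move=> mu1; apply/funext => x; rewrite /increment /combination.
set B := (Num.truncn (mu ^+ j.+1)).+1.
have tB : mu ^+ j.+1 < B%:R by exact: truncnS_gt.
have mono : mu ^+ j <= mu ^+ j.+1 by rewrite ler_weXn2l// ltW.
rewrite (big_incr_range _ _ tB) (dilated_sumE _ _ _ _ tB)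
  (dilated_sumE _ _ _ _ (le_lt_trans mono tB)).
rewrite (bigID (fun k => k%:R <= mu ^+ j)) /= addrC.
rewrite [X in _ + X - _](_ : _ =
  \sum_(k <- iota 0 B | (k \in N) && (k%:R <= mu ^+ j))
    (c k)%:C%C * dilate f k x); last first.
  apply: eq_bigl => k; rewrite -andbA; congr (_ && _).
  by apply/andP/idP => [[]//|kj]; rewrite (le_trans kj).
by rewrite addrK; apply: eq_bigl => k; rewrite -andbA -ltNge; congr (_ && _);
  exact: andbC.
Qed.

Lemma sum_incr_range N mu (g : nat -> R) J (B : nat) : 1 < mu ->
  mu ^+ J < B%:R ->
  \sum_(0 <= j < J) \sum_(k <- incr_range N mu j) g k =
  \sum_(k <- iota 0 B | (k \in N) && ((1 : R) < k%:R <= mu ^+ J)) g k.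
Proof.
move=> mu1; elim: J => [|J ih] tB.
  rewrite big_nil big1// => k /and3P[_ k1]; rewrite expr0 => kle.
  by move: (lt_le_trans k1 kle); rewrite ltxx.
have mono : mu ^+ J <= mu ^+ J.+1 by rewrite ler_weXn2l// ltW.
have muJ : 1 <= mu ^+ J by rewrite exprn_ege1// ltW.
rewrite big_nat_recr//= ih ?(le_lt_trans mono tB)// (big_incr_range _ _ tB).
rewrite [RHS](bigID (fun k => k%:R <= mu ^+ J)) /=; congr (_ + _);
  apply: eq_bigl => k.
  rewrite -andbA; congr (_ && _); rewrite -andbA; congr (_ && _).
  by apply/idP/andP => [kJ|[]//]; rewrite (le_trans kJ).
rewrite -andbA; congr (_ && _); rewrite -ltNge.
by apply/andP/andP => [[kJ ->]|[/andP[_ ->] ->]]//;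
  rewrite kJ (le_lt_trans muJ).
Qed.

Section IncrementEstimate.
Variables (f : R -> R[i]) (a : int -> R[i]) (M : R) (N : set nat) (mu : R).
Hypotheses (hf : L2circle f) (ha : fourier_series f a) (ha0 : a 0 = 0).
Hypotheses (hM : 1 < M) (hL : (window_series a M < +oo)%E).
Hypothesis N0 : forall k, N k -> (0 < k)%N.
Hypothesis hmu : 1 < mu.

Let f2 : inL2 f. Proof. exact: L2circle_inL2. Qed.
Let pf : periodic f 1. Proof. by case: hf. Qed.

Lemma incr_range_pos j : all (leq 1) (incr_range N mu j).
Proof. by apply/allP => k; rewrite mem_incr_range => /andP[/set_mem /N0]. Qed.

Lemma inL2_increment c j : inL2 (increment f N c mu j).
Proof.
by rewrite incrementE//; apply: inL2_combination => //; exact: incr_range_pos.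
Qed.

Definition off_diagonal (K : seq nat) (k : nat) : R :=
  \sum_(l <- K | l != k) (gcdn l k)%:R / (maxn l k)%:R.

Lemma sqnorm_combination_incr_range j K c (theta : R) : uniq K ->
  {subset K <= incr_range N mu j} ->
  (forall k, k \in K -> off_diagonal K k <= theta) ->
  sqnorm (combination f K c) <=
    M * energy a M * (1 + mu) * (1 + theta) * \sum_(k <- K) c k ^+ 2.
Proof.
move=> uK sK offK.
have posK k : k \in K -> (0 < k)%N by move=> /sK /(allP (incr_range_pos j)).
have K0 : all (leq 1) K by apply/allP.
have cmp k l : k \in K -> l \in K -> k%:R <= mu * l%:R.
  move=> /sK; rewrite mem_incr_range => /and3P[_ _ kle] /sK.
  rewrite mem_incr_range => /and3P[_ ll _]; apply: le_trans kle _.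
  by rewrite exprS ler_pM2l ?(lt_trans ltr01)// ltW.
have E0 : 0 <= M * energy a M * (1 + mu).
  by rewrite !mulr_ge0 ?energy_ge0 ?addr_ge0// ltW// (lt_trans ltr01).
apply: (@sqnorm_combination_le _ f a pf f2 ha K c
  (fun k l => M * energy a M * (1 + mu) *
    ((gcdn k l)%:R / (maxn k l)%:R))) => //.
- by move=> k l kK lK J; apply: gram_le_gcd => //;
    [exact: posK|exact: posK|exact: cmp|exact: cmp].
- by move=> k l; rewrite gcdnC maxnC.
- move=> k kK; rewrite -mulr_sumr; apply: ler_wpM2l => //.
  rewrite (bigD1_seq k)//= gcdnn maxnn divff ?lerD2l; last first.
    by rewrite pnatr_eq0 -lt0n posK.
  apply: le_trans (offK k kK); rewrite /off_diagonal le_eqVlt; apply/orP; left;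
    apply/eqP.
  by apply: eq_bigr => l _; rewrite gcdnC maxnC.
Qed.

(** What remains inside the block number [j]; only the index equal to
[mu^(j+1)] is lost. *)
Definition incr_block j := [seq k <- incr_range N mu j | k%:R < mu ^+ j.+1].

(** The factor 2 pays for treating the index [mu^(j+1)] apart: its gcd sum is trivial,
while inside the block the hypothesis applies. *)
Lemma sqnorm_increment_le (theta : R) j c : 0 <= theta ->
  (forall k, k \in incr_block j -> off_diagonal (incr_block j) k <= theta) ->
  sqnorm (increment f N c mu j) <=
    2 * (M * energy a M * (1 + mu) * (1 + theta)) *
    \sum_(k <- incr_range N mu j) c k ^+ 2.
Proof.
move=> theta0 off; rewrite incrementE//.
set W := incr_range N mu j; set D := M * _ * _ * _.
(* At most one index, namely mu^(j+1) when it belongs to N. *)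
pose top := [seq k <- W | ~~ (k%:R < mu ^+ j.+1)].
have splitW (V : nmodType) (g : nat -> V) :
    \sum_(k <- W) g k = \sum_(k <- incr_block j) g k + \sum_(k <- top) g k.
  by rewrite (bigID (fun k : nat => k%:R < mu ^+ j.+1)) /= !big_filter.
have uB : uniq (incr_block j) by rewrite filter_uniq// uniq_incr_range.
have uT : uniq top by rewrite filter_uniq// uniq_incr_range.
have sB : {subset incr_block j <= W} by move=> k; rewrite mem_filter => /andP[].
have sT : {subset top <= W} by move=> k; rewrite mem_filter => /andP[].
have posB : all (leq 1) (incr_block j).
  by apply/allP => k /sB /(allP (incr_range_pos j)).
have posT : all (leq 1) top by apply/allP => k /sT /(allP (incr_range_pos j)).
have topE k : k \in top -> k%:R = mu ^+ j.+1.
  rewrite mem_filter -leNgt mem_incr_range => /andP[le1 /and3P[_ _ le2]].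
  by apply/eqP; rewrite eq_le le2.
have offT k : k \in top -> off_diagonal top k <= theta.
  move=> kT; rewrite /off_diagonal big_seq_cond big1// => l /andP[lT].
  by rewrite -(eqr_nat R) (topE _ kT) (topE _ lT) eqxx.
have -> : combination f W c =
  fun x => combination f (incr_block j) c x + combination f top c x.
  by apply/funext => x; rewrite /combination splitW.
apply: le_trans (sqnormD_le _ _) _; try exact: inL2_combination.
rewrite splitW -mulrA mulrDr -[leLHS]mulrDr ler_pM2l// lerD//.
  exact: sqnorm_combination_incr_range sB off.
exact: sqnorm_combination_incr_range sT offT.
Qed.

Lemma sqnorm_increment_ge j c : constant_sign a -> constant_sign c ->
  sqnorm f * \sum_(k <- incr_range N mu j) c k ^+ 2 <=
    sqnorm (increment f N c mu j).
Proof.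
move=> sa sc; rewrite incrementE//.
by apply: (sqnorm_combination_ge pf f2 ha) => //;
  [exact: incr_range_pos|exact: uniq_incr_range].
Qed.

(** A crude bound for the finitely many blocks that escape an asymptotic
hypothesis. *)
Lemma off_diagonal_le_size K k : (0 < k)%N -> off_diagonal K k <= (size K)%:R.
Proof.
move=> k0; rewrite /off_diagonal; apply: (@le_trans _ _ (\sum_(l <- K) 1));
  last first.
  by rewrite big_const_seq count_predT iter_addr_0.
rewrite big_mkcond; apply: ler_sum => l _; case: ifP => // _.
have m0 : (0 < maxn l k)%N by rewrite leq_max k0 orbT.
rewrite ler_pdivrMr ?ltr0n//
  mul1r ler_nat (leq_trans (dvdn_leq k0 (dvdn_gcdr l k)))//.
exact: leq_maxr.
Qed.

Lemma off_diagonal_le_vartheta j k : k \in incr_block j ->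
  ((off_diagonal (incr_block j) k)%:E <= vartheta (block N mu j))%E.
Proof.
have inB l : l \in incr_block j -> block N mu j l.
  rewrite mem_filter mem_incr_range => /andP[lt /and3P[/set_mem Nl gt _]].
  by split => //=; rewrite lt (ltW gt).
move=> kB; apply: (@le_trans _ _ (vartheta_at (block N mu j) k)); last first.
  by apply: ereal_sup_ubound; right; exists k => //; exact: inB.
apply: ereal_sup_ubound; exists [set` [seq l <- incr_block j | l != k]].
  split; first exact: finite_seq.
  move=> l /=; rewrite mem_filter => /andP[lk lB]; split; first exact: inB.
  by move=> /= lk'; rewrite lk' eqxx in lk.
have us : uniq [seq l <- incr_block j | l != k] by rewrite !filter_uniq//
  iota_uniq.
by rewrite -(fsbig_seq _ _ us) big_filter /off_diagonal -sumEFin.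
Qed.

Lemma vartheta_ge0 K : (0 <= @vartheta R K)%E.
Proof. by apply: ereal_sup_ubound; left. Qed.

Lemma square_functionE c : square_function f N c mu =
  sqrte (\sum_(0 <= j <oo) (sqnorm (increment f N c mu j))%:E)%E.
Proof.
rewrite /square_function poweR12_sqrt; last first.
  by apply: nneseries_ge0 => j _ _; rewrite L2norm2 integral_ge0// => x _;
    rewrite lee_fin dot_ge0.
congr sqrte; apply: eq_eseriesr => j _; rewrite L2norm2.
exact: inL2_integral (inL2_increment c j).
Qed.

Lemma ell2normE c : ell2norm c = sqrte (\sum_(0 <= k <oo) (c k ^+ 2)%:E)%E.
Proof.
rewrite /ell2norm Lnorm_counting// poweR12_sqrt; last first.
  by apply: nneseries_ge0 => k _ _; exact: poweR_ge0.
congr sqrte; apply: eq_eseriesr => k _ /=.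
by rewrite powR_mulrn// real_normK// num_real.
Qed.

Lemma square_function_le (theta : R) : 0 <= theta ->
  (forall j k, k \in incr_block j -> off_diagonal (incr_block j) k <= theta) ->
  exists C : R, forall c, (square_function f N c mu <= C%:E * ell2norm c)%E.
Proof.
move=> theta0 off; pose C := 2 * (M * energy a M * (1 + mu) * (1 + theta)).
have C0 : 0 <= C.
  rewrite !mulr_ge0 ?energy_ge0 ?addr_ge0// ltW// (lt_trans ltr01)//.
exists (Num.sqrt C) => c; rewrite square_functionE ell2normE.
rewrite -[(Num.sqrt C)%:E]/(sqrte C%:E) -sqrteM ?lee_fin// lee_sqrt; last first.
  by rewrite mule_ge0 ?lee_fin// nneseries_ge0// => k _ _;
    rewrite lee_fin sqr_ge0.
apply: lime_le; first by apply: is_cvg_nneseries => j _ _;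
  rewrite lee_fin ip_ge0.
apply: nearW => J; rewrite sumEFin.
pose B := (Num.truncn (mu ^+ J)).+1.
apply: (@le_trans _ _ (C * \sum_(0 <= k < B) c k ^+ 2)%:E).
  rewrite lee_fin; apply: (@le_trans _ _
    (\sum_(0 <= j < J) C * \sum_(k <- incr_range N mu j) c k ^+ 2)).
    by apply: ler_sum => j _; apply: sqnorm_increment_le => // k; exact: off.
  rewrite -mulr_sumr ler_wpM2l//
    (sum_incr_range _ _ hmu (truncnS_gt (mu ^+ J))) -/B.
  rewrite /index_iota subn0 big_mkcond /=; apply: ler_sum => k _;
    case: ifP => // _.
  exact: sqr_ge0.
rewrite EFinM lee_wpmul2l ?lee_fin// -sumEFin; apply: nneseries_lim_ge => k _ _.
by rewrite lee_fin sqr_ge0.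
Qed.

(** Every active index up to [B] lies in one of the ranges of the increments of
order less than [J] as soon as [mu^J > B]. *)
Lemma square_function_ge c : constant_sign a -> constant_sign c ->
  (L2norm f * ell2norm (c \_ (active N)) <= square_function f N c mu)%E.
Proof.
move=> sa sc; rewrite square_functionE ell2normE L2norm_integral
  (inL2_integral f2).
rewrite poweR12_sqrt ?lee_fin ?ip_ge0// -sqrteM ?lee_fin ?ip_ge0// lee_sqrt;
  last first.
  by apply: nneseries_ge0 => j _ _; rewrite lee_fin ip_ge0.
rewrite -nneseriesZl; last by move=> k _; rewrite lee_fin sqr_ge0.
apply: lime_le.
  by apply: is_cvg_nneseries => k _ _;
    rewrite -EFinM lee_fin mulr_ge0 ?ip_ge0 ?sqr_ge0.
apply: nearW => B; have [J BJ] := exists_power B%:R hmu.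
apply: (@le_trans _ _
  (\sum_(0 <= j < J) (sqnorm (increment f N c mu j))%:E)%E); last first.
  by apply: nneseries_lim_ge => j _ _; rewrite lee_fin ip_ge0.
rewrite [leRHS]sumEFin; under eq_bigr do rewrite -EFinM;
  rewrite sumEFin lee_fin.
apply: (@le_trans _ _ (\sum_(0 <= j < J)
  sqnorm f * \sum_(k <- incr_range N mu j) c k ^+ 2)); last first.
  by apply: ler_sum => j _; exact: sqnorm_increment_ge.
rewrite -!mulr_sumr ler_wpM2l ?ip_ge0//.
(* A common list that contains the indices below B and all those up to mu^J. *)
pose B' := (B + (Num.truncn (mu ^+ J)).+1)%N.
have tB' : mu ^+ J < B'%:R by rewrite (lt_le_trans (truncnS_gt _))//
  ler_nat leq_addl.
rewrite (sum_incr_range _ _ hmu tB') /B' iotaD big_cat /= ler_wpDr ?sumr_ge0//.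
  by move=> k _; exact: sqr_ge0.
rewrite [leRHS]big_mkcond /index_iota subn0 big_seq [leRHS]big_seq;
  apply: ler_sum => k.
rewrite mem_iota add0n => /andP[_ kB]; rewrite patchE.
have [kA|kA] := boolP (k \in active N); last by rewrite expr0n;
  case: ifP => // _; exact: sqr_ge0.
move/set_mem: kA => [Nk /= k1]; rewrite mem_set//= ltr1n k1 /=.
by rewrite (le_trans _ (ltW BJ))// ler_nat ltnW.
Qed.

End IncrementEstimate.

Lemma cvge0_lt1 (u : nat -> \bar R) : u j @[j --> \oo] --> 0%E ->
  \forall j \near \oo, (u j < 1%:E)%E.
Proof.
move=> /fine_cvgP[ufin /cvgrPdist_lt /(_ 1 ltr01) ulim].
near=> j; have fin : u j \is a fin_num by near: j.
rewrite -(fineK fin) lte_fin (le_lt_trans (ler_norm _))// -normrN -[- _]add0r.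
by near: j.
Unshelve. all: by end_near.
Qed.

End Assembly.

Theorem theorem2p1 (R : realType) (f : R -> R[i]) (a : int -> R[i]) (M : R)
    (n : nat -> nat)
    (hf : L2circle f) (ha : fourier_series f a) (ha0 : a 0 = 0)
    (hM : 1 < M) (hL : (window_series a M < +oo)%E)
    (hn_pos : forall k, (1 <= k)%N -> (0 < n k)%N)
    (hn_incr : forall k l, (1 <= k)%N -> (k < l)%N -> (n k < n l)%N) :
  ((forall mu : R, 1 < mu ->
      (ereal_sup [set @vartheta R (block (index_set n) mu j) | j in setT]
         < +oo)%E) ->
   forall mu : R, 1 < mu ->
   exists C : R, forall c : nat -> R, ell2 c ->
     (square_function f (index_set n) c mu <= C%:E * ell2norm c)%E)
  /\
  ((forall mu : R, 1 < mu ->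
      @vartheta R (block (index_set n) mu j) @[j --> \oo] --> 0%E) ->
   constant_sign a ->
   forall mu : R, 1 < mu ->
   exists C : R, forall c : nat -> R, ell2 c -> constant_sign c ->
     (L2norm f * ell2norm (c \_ (active (index_set n)))
        <= square_function f (index_set n) c mu)%E /\
     (square_function f (index_set n) c mu <= C%:E * ell2norm c)%E).
Proof.
set N := index_set n.
have N0 k : N k -> (0 < k)%N by move=> [i /= i1 <-]; exact: hn_pos.
split=> [hv mu hmu|hv sa mu hmu].
  pose S := ereal_sup [set @vartheta R (block N mu j) | j in setT].
  have Sle j : (vartheta (block N mu j) <= S)%E by apply: ereal_sup_ubound; exists j.
  have S0 : (0 <= S)%E := le_trans (vartheta_ge0 _) (Sle 0%N).
  have Sfin : S \is a fin_num by rewrite ge0_fin_numE//; exact: hv.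
  have off j k : k \in incr_block N mu j -> off_diagonal (incr_block N mu j) k <= fine S.
    move=> kB; rewrite -lee_fin fineK//.
    exact: le_trans (off_diagonal_le_vartheta kB) (Sle j).
  have [C hC] := square_function_le hf ha ha0 hM hL N0 hmu (fine_ge0 S0) off.
  by exists C.
have [j0 _ hj0] : \forall j \near \oo, (@vartheta R (block N mu j) < 1%:E)%E.
  exact: cvge0_lt1 (hv mu hmu).
(* From j0 on the gcd sums are at most 1; the earlier blocks are finite. *)
pose s := \big[maxn/0%N]_(j < j0) size (incr_block N mu j).
have off j k : k \in incr_block N mu j -> off_diagonal (incr_block N mu j) k <= s%:R + 1 :> R.
  move=> kB; have [jj0|j0j] := ltnP j j0.
    have k0 : (0 < k)%N by move: kB; rewrite mem_filter => /andP[_ /(allP (incr_range_pos _ N0 _))].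
    apply: le_trans (off_diagonal_le_size _ k0) _.
    rewrite -[leLHS]addr0 lerD// ler_nat.
    exact: (@leq_bigmax _ (fun j : 'I_j0 => size (incr_block N mu j)) (Ordinal jj0)).
  have v1 := le_trans (off_diagonal_le_vartheta kB) (ltW (hj0 j j0j)).
  by rewrite lee_fin in v1; apply: le_trans v1 _; rewrite lerDr.
have [C hC] := square_function_le hf ha ha0 hM hL N0 hmu (addr_ge0 (ler0n R s) ler01) off.
exists C => c _ sc; split => //.
exact: (@square_function_ge _ _ _ N _ hf ha N0 hmu _ sa sc).
Qed.
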